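(* Let $X$ be an irreducible shift of finite type and let $f\colon X \to \mathbb{R}$ be a potential with summable variation, that is, $f \in \mathrm{SV}(X)$. Then every $\sigma$-invariant Gibbs measure for $f$ is an equilibrium measure for $f$.
   Context: A shift space is a closed subset $X\subseteq \mathcal{A}^{\mathbb{Z}}$ ($\mathcal{A}$ a finite discrete alphabet, product topology) that is invariant under the shift $\sigma$, $(\sigma^n x)_0=x_n$. $\mathcal{B}(X)$ is the set of finite words appearing in points of $X$. A shift of finite type is a shift space consisting of all points of $\mathcal{A}^{\mathbb{Z}}$ in which no word from some finite set of forbidden words appears. $X$ is irreducible if for all $u,v\in\mathcal{B}(X)$ there is $w\in\mathcal{B}(X)$ with $uwv\in\mathcal{B}(X)$. All measures are Borel probability measures. Gibbs relation: $\mathfrak{T}_X=\{(x,y)\in X\times X : x_n=y_n \text{ for all } n \text{ with } |n|>N, \text{ for some } N\ge 1\}$. A holonomy of $\mathfrak{T}_X$ is a Borel isomorphism $\psi\colon A\to B$ between Borel sets $A,B\subseteq X$ with $(x,\psi(x))\in\mathfrak{T}_X$ for all $x\in A$. A measure $\mu$ is $\mathfrak{T}_X$-nonsingular if for every Borel $A$ with $\mu(A)=0$, the saturation $\mathfrak{T}_X(A)=\{x' : \exists x\in A,\ (x,x')\in\mathfrak{T}_X\}$ has $\mu(\mathfrak{T}_X(A))=0$. A cocycle is a Borel function $\phi\colon\mathfrak{T}_X\to\mathbb{R}$ with $\phi(x,y)+\phi(y,z)=\phi(x,z)$ whenever $(x,y),(y,z)\in\mathfrak{T}_X$. A measure $\mu$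 on $X$ is a Gibbs measure for the cocycle $\phi$ if it is $\mathfrak{T}_X$-nonsingular and for every holonomy $\psi\colon A\to B$ of $\mathfrak{T}_X$, $\frac{d(\mu\circ\psi)}{d\mu}(x)=\exp(\phi(x,\psi(x)))$ for $\mu$-a.e. $x\in A$, where $(\mu\circ\psi)(E)=\mu(\psi(E))$ for Borel $E\subseteq A$. Potentials: for continuous $f\colon X\to\mathbb{R}$ put $v_k(f)=\sup\{|f(x)-f(y)| : x_{[-k,k]}=y_{[-k,k]}\}$ for $k\ge 0$ and $v_{-1}(f)=\|f\|_\infty$. $\mathrm{SV}(X)$ is the set of continuous $f$ with $\sum_{k=0}^\infty v_{k-1}(f)<\infty$. For $f\in\mathrm{SV}(X)$ the absolutely convergent series $\phi_f(x,y)=\sum_{n\in\mathbb{Z}}[f(\sigma^n y)-f(\sigma^n x)]$ defines a cocycle on $\mathfrak{T}_X$; a Gibbs measure for $f$ means a Gibbs measure for $\phi_f$. An equilibrium measure for a continuous $f\colon X\to\mathbb{R}$ is a $\sigma$-invariant measure $\mu$ on $X$ attaining the supremum $P_X(\sigma,f)=\sup\{h(\mu)+\int_X f\,d\mu\}$ over all $\sigma$-invariant measures on $X$, where $h(\mu)$ is the measure-theoretic (Kolmogorov–Sinai) entropy with respect to $\sigma$. *)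

(* Defs.v *)
From HB Require Import structures.
From mathcomp Require Import all_boot all_order all_algebra.
From mathcomp Require Import all_classical all_reals all_analysis.

Set Implicit Arguments.
Unset Strict Implicit.
Unset Printing Implicit Defensive.
Import Order.TTheory GRing.Theory Num.Theory.
Import numFieldNormedType.Exports.

Local Open Scope classical_set_scope.
Local Open Scope charge_scope.
Local Open Scope ring_scope.

(* The distinguished letter is only there because measurable types must be
   pointed; over the empty alphabet there is no probability measure anyway. *)
#[short(type="alphabetType")]
HB.structure Definition Alphabet := {A of Finite A & Pointed A}.

Definition full_shift (A : alphabetType) : Type :=
  {ptws int -> discrete_topology A}.

HB.instance Definition _ (A : alphabetType) :=
  Topological.copy (full_shift A) {ptws int -> discrete_topology A}.
HB.instance Definition _ (A : alphabetType) :=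
  isPointed.Build (full_shift A) (fun=> point).
HB.instance Definition _ (A : alphabetType) :=
  Measurable.copy (full_shift A) (g_sigma_algebraType (@open (full_shift A))).

Section shift_spaces.
Variable A : alphabetType.
Implicit Types (x y : full_shift A) (X : set (full_shift A)) (w : seq A).

Definition shift_map (n : int) x : full_shift A := fun m => x (m + n).

Definition window x (i : int) (n : nat) : seq A :=
  mkseq (fun j => x (i + j%:Z)) n.

Definition appears w x := exists i : int, window x i (size w) = w.

Definition language X : set (seq A) :=
  [set w | exists2 x, X x & appears w x].

Definition is_shift_space X :=
  closed X /\ forall (n : int) x, X x -> X (shift_map n x).

Definition is_sft X :=
  is_shift_space X /\
  exists F : seq (seq A), X = [set x | forall w, w \in F -> ~ appears w x].

Definition is_irreducible X :=
  forall u v, language X u -> language X v ->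
  exists2 w, language X w & language X (u ++ w ++ v).

Definition gibbs_rel X x y :=
  [/\ X x, X y & exists2 N : nat, (1 <= N)%N &
      forall n : int, (N < `|n|)%N -> x n = y n].

Definition saturation X (E : set (full_shift A)) : set (full_shift A) :=
  [set y | exists2 x, E x & gibbs_rel X x y].

(* psi is a total function of which only the restriction to E matters; the
   third clause says that psi : E -> F is a Borel isomorphism. *)
Definition is_holonomy X (E F : set (full_shift A))
    (psi : full_shift A -> full_shift A) :=
  [/\ measurable E /\ E `<=` X,
      measurable F /\ F `<=` X,
      [/\ set_bij E F psi, measurable_fun E psi &
          forall G, measurable G -> G `<=` E -> measurable (psi @` G)] &
      forall x, E x -> gibbs_rel X x (psi x)].

End shift_spaces.

Section entropy.
Context d (T : measurableType d) (R : realType).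
Local Open Scope ereal_scope.

Definition is_finite_partition (D : set T) (k : nat) (P : 'I_k -> set T) :=
  partition [set: 'I_k] P D /\ forall i, measurable (P i).

(* The atoms of the join of the S^-i P, i < n, indexed by their itineraries;
   the empty ones contribute 0 to the entropy of the join. *)
Definition join_atom (D : set T) (S : T -> T) (k : nat) (P : 'I_k -> set T)
    (n : nat) (c : {ffun 'I_n -> 'I_k}) : set T :=
  D `&` \bigcap_(i in [set: 'I_n]) (iter i S @^-1` P (c i)).

(* ln 0 = 0, so this is also correct at t = 0. *)
Definition entropy_fun (t : R) : R := (- (t * ln t))%R.

Definition join_entropy (mu : probability T R) (D : set T) (S : T -> T)
    (k : nat) (P : 'I_k -> set T) (n : nat) : R :=
  (\sum_(c : {ffun 'I_n -> 'I_k}) entropy_fun (fine (mu (join_atom D S P c))))%R.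

Definition partition_entropy (mu : probability T R) (D : set T) (S : T -> T)
    (k : nat) (P : 'I_k -> set T) : R :=
  limn (fun n => (join_entropy mu D S P n / n%:R)%R).

Definition KS_entropy (mu : probability T R) (D : set T) (S : T -> T) : \bar R :=
  ereal_sup [set h | exists k (P : 'I_k -> set T),
    is_finite_partition D P /\ h = (partition_entropy mu D S P)%:E].

End entropy.

Section thermodynamics.
Variables (R : realType) (A : alphabetType).
Implicit Types (x y : full_shift A) (X : set (full_shift A)).
Implicit Types (f : full_shift A -> R) (mu : probability (full_shift A) R).

(* Borel probability measures on X are identified with the Borel probability
   measures on the full shift that give mass 1 to X, and functions on X with
   functions on the full shift whose values off X are irrelevant. *)
Definition measure_on X mu := mu X = 1%E.

Definition shift_invariant mu :=
  forall E, measurable E -> mu (shift_map 1 @^-1` E) = mu E.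

Definition gibbs_nonsingular X mu :=
  forall E, measurable E -> E `<=` X -> mu E = 0%E -> mu (saturation X E) = 0%E.

(* nu is the measure mu \o psi on E, extended by 0 to the full shift *)
Definition is_gibbs_for_cocycle X (phi : full_shift A -> full_shift A -> R) mu :=
  [/\ measure_on X mu,
      gibbs_nonsingular X mu &
      forall E F psi, is_holonomy X E F psi ->
      exists nu : {charge set (full_shift A) -> \bar R},
        (forall G, measurable G -> nu G = mu (psi @` (G `&` E))) /\
        {ae mu, forall x, E x ->
          ('d nu '/d mu) x = (expR (phi x (psi x)))%:E}].

Definition osc X f (k : nat) : R :=
  sup [set r | exists x y, [/\ X x, X y,
    (forall n : int, (`|n| <= k)%N -> x n = y n) & r = `|f x - f y|]].

Definition sup_norm X f : R := sup [set `|f x| | x in X].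

(* potential_var X f k is v_(k-1)(f) *)
Definition potential_var X f (k : nat) : R :=
  if k is k'.+1 then osc X f k' else sup_norm X f.

Definition summable_variation X f :=
  {within X, continuous f} /\ cvgn (series (potential_var X f)).

Definition int_series (g : int -> R) : R :=
  limn (series (fun n : nat => g n%:Z)) +
  limn (series (fun n : nat => g (- n.+1%:Z))).

Definition cocycle_of f x y : R :=
  int_series (fun n => f (shift_map n y) - f (shift_map n x)).

Definition is_gibbs X f mu := is_gibbs_for_cocycle X (cocycle_of f) mu.

Definition free_energy X f mu : \bar R :=
  (KS_entropy mu X (shift_map 1) + \int[mu]_(x in X) (f x)%:E)%E.

Definition pressure X f : \bar R :=
  ereal_sup [set p | exists mu,
    [/\ measure_on X mu, shift_invariant mu & p = free_energy X f mu]].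

Definition is_equilibrium X f mu :=
  [/\ measure_on X mu, shift_invariant mu & free_energy X f mu = pressure X f].

End thermodynamics.

(* Main.v *)
(* Let S_n f be the Birkhoff sums and Z_n the sum of exp (S_n f) over the words
   of length n of X, evaluated at a chosen point of each cylinder. By Fekete's
   lemma (ln Z_n) / n converges to some p.

   Any invariant nu has h(nu) + int f dnu <= p. A finite Borel partition P is
   approximated by a partition Q read off the coordinates in [-N, N]; the joint
   law of the P-itinerary c of length n and of the word w on [-N, n + N) is
   compared, through the inequality entropy <= cross entropy, with the law
   exp (S_m f (w)) / Z_m * prod_i kappa (c_i | Q_i (w)), where m = n + 2N and
   kappa (. | j) is concentrated near j.

   For the Gibbs measure mu, any word v of length n can be spliced, with the
   help of irreducibility, into a window of a point of the cylinder of another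
   word w without changing the ends of the window. Overwriting that window is a
   holonomy, and bounded distortion turns the Gibbs condition into
   mu[w] exp (S_n f (v)) <= C exp (S_n f (w)) mu[v]. Summing over v gives
   Z_n mu[w] <= C exp (S_n f (w)), hence H_n(mu) + n int f dmu >= ln Z_n - O(1)
   for the partition by the letter at 0. *)

Require Import Defs.
From mathcomp Require Import all_boot all_order all_algebra.
From mathcomp Require Import all_classical all_reals all_analysis.
From mathcomp Require Import measurable_realfun ring lra zify.
Set Implicit Arguments.
Unset Strict Implicit.
Unset Printing Implicit Defensive.
Import Order.TTheory GRing.Theory Num.Theory.
Import numFieldNormedType.Exports.
Local Open Scope classical_set_scope.
Local Open Scope charge_scope.
Local Open Scope ring_scope.

(** * Topology of the full shift *)

Section topology.
Variable A : alphabetType.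
Implicit Types x y z : full_shift A.

Definition agree N x y := forall n : int, (`|n| <= N)%N -> y n = x n.

Lemma agree_sym N x y : agree N x y -> agree N y x.
Proof. by move=> xy n nN; rewrite xy. Qed.

Lemma agree_trans N x y z : agree N x y -> agree N y z -> agree N x z.
Proof. by move=> xy yz n nN; rewrite yz// xy. Qed.

Lemma agree_le M N x y : (M <= N)%N -> agree N x y -> agree M x y.
Proof. by move=> MN xy n nM; apply: xy; exact: leq_trans MN. Qed.

Lemma full_shift_cvg (F : set_system (full_shift A)) {FF : Filter F} x :
  (forall n : int, F [set y | y n = x n]) -> F --> x.
Proof.
move=> h; apply/cvg_sup => n B; rewrite nbhsE /= => -[_ [[U oU <-] Ux] UB].
by apply: filterS (h n) => y /= yx; apply: UB; rewrite /= yx.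
Qed.

Lemma nbhs_coord x (n : int) : nbhs x [set y | y n = x n].
Proof.
have /cvg_sup/(_ n) : nbhs x --> x by [].
apply; rewrite nbhsE /=; exists [set y | y n = x n] => //; split => //.
by exists [set x n] => //; exact: discrete_open.
Qed.

Lemma nbhs_agree x N : nbhs x (agree N x).
Proof.
elim: N => [|N IH].
  apply: filterS (nbhs_coord x 0) => y /= yx n n0.
  by have -> : n = 0 by lia.
apply: filterS (filterI IH (filterI (nbhs_coord x N.+1%:Z)
  (nbhs_coord x (- N.+1%:Z)))) => y [xy [/= y1 y2]] n nN.
have [nN'|] := leqP `|n| N; first exact: xy.
by move=> nN'; have [->|->] : n = N.+1%:Z \/ n = - N.+1%:Z by lia.
Qed.

(** If no central cylinder around [x] fits into [U], choosing a point of [agree N x] outside [U] for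
    each [N] gives a sequence converging to [x], against openness. *)
Lemma full_shift_openP (U : set (full_shift A)) :
  open U <-> forall x, U x -> exists N, agree N x `<=` U.
Proof.
split=> [oO x Ox|h].
  apply: contrapT => /forallNP nO.
  have /choice[y yP] N : exists z, agree N x z /\ ~ U z.
    by have /existsNP[z /not_implyP[? ?]] := nO N; exists z.
  have /(_ U (open_nbhs_nbhs (conj oO Ox))) : y @ \oo --> x.
    apply: full_shift_cvg => n.
    by exists `|n|%N => // N /= nN; apply: (yP N).1.
  by move=> [N _ /(_ N (leqnn N))]; apply: (yP N).2.
rewrite openE => x Ox; have [N NO] := h _ Ox.
by apply: filterS NO _; exact: nbhs_agree.
Qed.

Lemma full_shift_compact : compact [set: full_shift A].
Proof.
have := @tychonoff int (fun=> discrete_topology A) (fun=> setT).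
have -> : [set f : (forall i : int, discrete_topology A) | forall i, setT (f i)]
  = setT by apply/seteqP; split.
by apply => n; apply: finite_compact; exact: (@finite_finset A).
Qed.

Lemma measurable_open (U : set (full_shift A)) : open U -> measurable U.
Proof. by move=> oO; exact: sub_sigma_algebra. Qed.

Lemma measurable_closed (U : set (full_shift A)) : closed U -> measurable U.
Proof.
move=> cO; rewrite -(setCK U); apply: measurableC; apply: measurable_open.
by rewrite openC.
Qed.

(** Finite unions of cylinders over the window [-N, N]; these clopen sets form the algebra used to
    approximate Borel sets. *)
Definition local_set N (C : set (full_shift A)) :=
  forall x y, agree N x y -> C x -> C y.

Lemma local_setC N C : local_set N C -> local_set N (~` C).
Proof. by move=> h x y /agree_sym xy Cx Cy; apply: Cx; exact: h Cy. Qed.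

Lemma local_set_le M N C : (M <= N)%N -> local_set M C -> local_set N C.
Proof. by move=> MN h x y /(agree_le MN); exact: h. Qed.

Lemma measurable_local N C : local_set N C -> measurable C.
Proof.
move=> h; apply: measurable_open; apply/full_shift_openP => x Cx.
by exists N => y /h; apply.
Qed.

(** The hypothesis is continuity of [psi], phrased with central cylinders. *)
Lemma measurable_fun_full_shift (psi : full_shift A -> full_shift A) :
  (forall x N, exists M, forall y, agree M x y -> agree N (psi x) (psi y)) ->
  measurable_fun setT psi.
Proof.
move=> h; apply: (measurability (@open (full_shift A))) => [|_ [U oO <-]]; first by [].
rewrite setTI; apply: measurable_open.
apply/full_shift_openP => x Ox.
have [N NO] := (full_shift_openP U).1 oO (psi x) Ox.
have [M MN] := h x N.
by exists M => y xy; apply: NO; exact: MN.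
Qed.

Lemma measurable_shift_map k :
  measurable_fun setT (shift_map k : full_shift A -> full_shift A).
Proof.
apply: measurable_fun_full_shift => x N; exists (N + `|k|)%N => y xy n nN.
by rewrite /shift_map xy//; lia.
Qed.

End topology.

(** * Connecting words, and Fekete's lemma *)

Section connection.
(** [E n a b] is to be read as a walk of length [n] from [a] to [b] in a strongly connected finite
    graph on the valid vertices. *)
Variables (S : finType) (E : nat -> S -> S -> Prop) (valid : S -> Prop).
Hypothesis Evalid : forall n a b, E n a b -> valid a /\ valid b.
Hypothesis Ecat : forall m n a b c, E m a b -> E n b c -> E (m + n) a c.
Hypothesis Eirr : forall a b, valid a -> valid b ->
  exists2 k, (0 < k)%N & E k a b.

Lemma loop_iter a n k : (0 < k)%N -> E n a a -> E (k * n) a a.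
Proof.
case: k => // k _ Ea; elim: k => [|k IH]; first by rewrite mul1n.
by rewrite mulSn; exact: Ecat IH.
Qed.

(** Each valid vertex has a loop; the product of the chosen loop lengths is a multiple of each of
    them, and loops can be iterated. *)
Lemma common_loop : exists2 D, (0 < D)%N &
  forall a k, valid a -> (0 < k)%N -> E (k * D) a a.
Proof.
have /choice[d dP] a : exists d, (0 < d)%N /\ (valid a -> E d a a).
  have [va|va] := pselect (valid a); last by exists 1%N.
  by have [d d0 Ed] := Eirr va va; exists d.
exists (\prod_a d a)%N; first by apply: prodn_gt0 => a; exact: (dP a).1.
move=> a k va k0; rewrite (bigD1 a)//= mulnCA mulnC.
apply: loop_iter; last exact: (dP a).2.
by rewrite muln_gt0 k0 /= prodn_gt0// => b; exact: (dP b).1.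
Qed.

(** There are finitely many triples of two end points and a residue modulo [D]. One walk is fixed
    for each realised triple, and every longer length in its class is reached by adding a loop at
    [a] whose length is a multiple of [D]. *)
Lemma path_residue D : (0 < D)%N ->
    (forall a k, valid a -> (0 < k)%N -> E (k * D) a a) ->
  exists K, forall a b m n, E m a b -> (K <= n)%N -> (n = m %[mod D])%N -> E n a b.
Proof.
move=> D0 DP.
have /choice[k kP] (t : S * S * 'I_D) : exists k, forall m n,
    E m t.1.1 t.1.2 -> (k <= n)%N -> (m %% D = t.2)%N -> (n %% D = t.2)%N ->
    E n t.1.1 t.1.2.
  case: t => -[a b] r /=.
  have [[m Em mr]|h] := pselect (exists2 m, E m a b & (m %% D = r)%N); last first.
    by exists 0%N => m n; move=> Em _ mr; case: h; exists m.
  exists m => m' n _ mn _ nr; have /eqP : (n = m %[mod D])%N by rewrite nr mr.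
  rewrite eqn_mod_dvd// => /dvdnP[[|c] nmc].
    by have -> : n = m by lia.
  have -> : n = (c.+1 * D + m)%N by lia.
  by apply: (Ecat _ Em); apply: DP => //; exact: (Evalid Em).1.
exists (\max_t k t)%N => a b m n Em Kn nm.
apply: (kP (a, b, Ordinal (ltn_pmod m D0))) => //=; first exact: Em.
by apply: leq_trans Kn; exact: leq_bigmax.
Qed.

(* The period of the graph never has to be computed: residues modulo a common
   multiple D of loop lengths suffice, and the lengths l1, l2 of two loops
   at p satisfy l2 - l1 = l2 + (2D - 1) l1 modulo D. *)
Lemma uniform_connection : exists T, forall n p q a b,
  E (n + T.*2) p q -> E n a b ->
  exists2 j, (j <= T.*2)%N & E j p a /\ E (T.*2 - j) b q.
Proof.
have [D D0 DP] := common_loop; have [K KP] := path_residue D0 DP.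
exists (K + D)%N; set T := (K + D)%N => n p q a b Epq Eab.
have [vp vq] := Evalid Epq; have [va vb] := Evalid Eab.
have [s _ Es] := Eirr vp va; have [t _ Et] := Eirr vb vq.
have [r _ Er] := Eirr vq vp.
pose l1 := (s + n + t + r)%N; pose l2 := (n + T.*2 + r)%N.
have El1 : E l1 p p by apply: Ecat Er; apply: Ecat Et; exact: Ecat Eab.
have El2 : E l2 p p by exact: Ecat Er.
(* Modulo [D] this length is l2 - l1 + s = 2T - t, so that what remains of 2T is congruent to the
   length [t] of the walk [Et] from [b] to [q]. *)
have El3 : E (l2 + (D + D.-1) * l1 + s) p a.
  apply: Ecat Es; apply: Ecat El2 _; apply: loop_iter => //; lia.
set m := (_ + s)%N in El3.
(* [j] is the representative of [m] modulo [D] in [K, K + D); the summand [D * K] keeps the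
   subtraction of [K] from truncating. *)
pose y := (m + D * K - K)%N; pose j := (K + y %% D)%N.
have yE := divn_eq y D; have yD := ltn_pmod y D0.
have KDK : (K <= D * K)%N by rewrite leq_pmull.
have jE : (j + y %/ D * D = m + D * K)%N by rewrite /j; lia.
exists j; first by rewrite /j /T; lia.
split; apply: KP; [exact: El3| by rewrite /j; lia | |exact: Et| by rewrite /j /T; lia |].
  by rewrite -(modnMDl (y %/ D) j) addnC jE addnC mulnC modnMDl.
rewrite -(modnMDl (l1.*2 + K) (T.*2 - j)) -(modnMDl (y %/ D) t).
congr (_ %% _)%N.
have jT : (j <= T.*2)%N by rewrite /j /T; lia.
have mE : (m = l2 + s + D * l1.*2 - l1)%N.
  rewrite /m; case: (D) D0 => // d _ /=; nia.
have l1D : (l1 <= D * l1.*2)%N by case: (D) D0 => // d _; nia.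
rewrite mulnDl (mulnC l1.*2) (mulnC K).
rewrite mE in jE; rewrite /l2 in jE; move: jE l1D; rewrite {-2 3 4}/l1; lia.
Qed.

End connection.

(** The limit is the infimum of [a n / n] over positive [n], finite by the linear lower bound.
    Writing [n] as a multiple of a nearly optimal period plus a remainder gives the upper
    estimate. *)
Lemma fekete (R : realType) (a : nat -> R) (B : R) :
  (forall m n, a (m + n)%N <= a m + a n) -> (forall n, - B * n%:R <= a n) ->
  exists l, forall e, 0 < e -> exists N, forall n, (N <= n)%N ->
    `|a n - l * n%:R| <= e * n%:R.
Proof.
move=> asub aB; pose s := [set a n.+1 / n.+1%:R | n in [set: nat]].
have sinf : has_inf s.
  split; first by exists (a 1%N / 1), 0%N.
  by exists (- B) => _ [n _ <-]; rewrite ler_pdivlMr ?ltr0n// aB.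
have amul N q : a (q * N)%N <= `|a 0%N| + q%:R * a N.
  elim: q => [|q IH]; first by rewrite mul0n mul0r addr0 ler_norm.
  by rewrite mulSn (le_trans (asub _ _))// -natr1 mulrDl mul1r; lra.
exists (inf s) => e e0.
have [_ [N _ <-] aN] : exists2 x, s x & x < inf s + e / 2.
  by apply: inf_lt; [exact: sinf.1|rewrite ltrDl divr_gt0].
rewrite ltr_pdivrMr ?ltr0n// in aN.
(* The error independent of the number of periods: [a 0], the remainder term [a r], and the slope
   over the [r] letters left out of the full periods. *)
pose C := `|a 0%N| + \sum_(r < N.+1) `|a r| + N.+1%:R * `|inf s + e / 2|.
have C0 : 0 <= C by rewrite !addr_ge0// ?sumr_ge0 ?mulr_ge0.
exists (Num.truncn (C / (e / 2))).+1 => n nN.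
have n0 : 0 <= n%:R :> R by [].
have Cn : C <= (e / 2) * n%:R.
  rewrite mulrC -ler_pdivrMr ?divr_gt0// ltW//.
  by apply: lt_le_trans (truncnS_gt _) _; rewrite ler_nat.
have lo : inf s * n%:R <= a n.
  case: n {nN n0 Cn} => [|n].
    by rewrite mulr0; have := aB 0%N; rewrite mulr0.
  by rewrite -ler_pdivlMr ?ltr0n//; apply: ge_inf; [exact: sinf.2|exists n].
have en0 : 0 <= e * n%:R by rewrite mulr_ge0// ltW.
rewrite ler_norml; apply/andP; split; first by lra.
have [q [r [rN nE]]] : exists q r : nat, (r < N.+1)%N /\ n = (q * N.+1 + r)%N.
  by exists (n %/ N.+1)%N, (n %% N.+1)%N; rewrite ltn_pmod//; split=> //; exact: divn_eq.
have ar : `|a r| <= \sum_(r < N.+1) `|a r|.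
  by rewrite (bigD1 (Ordinal rN))//= lerDl sumr_ge0.
have h1 : a n <= `|a 0%N| + q%:R * a N.+1 + `|a r|.
  by rewrite nE (le_trans (asub _ _))// lerD// ler_norm.
have h2 : q%:R * a N.+1 <= q%:R * ((inf s + e / 2) * N.+1%:R).
  by rewrite ler_wpM2l// ltW.
have h3 : q%:R * ((inf s + e / 2) * N.+1%:R) = (inf s + e / 2) * n%:R
   - r%:R * (inf s + e / 2).
  by rewrite nE natrD natrM; lra.
have h4 : - (r%:R * (inf s + e / 2)) <= N.+1%:R * `|inf s + e / 2|.
  rewrite -mulrN; apply: (@le_trans _ _ (r%:R * `|inf s + e / 2|)).
    by rewrite ler_wpM2l// -normrN ler_norm.
  by rewrite ler_wpM2r// ler_nat ltnW.
have h5 : a n <= (inf s + e / 2) * n%:R + C by rewrite /C; lra.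
by lra.
Qed.

(** * Integrals of bounded functions and entropy *)

Lemma probability_nonempty d (T : measurableType d) (R : realType)
    (mu : probability T R) (X : set T) : mu X = 1%E -> X !=set0.
Proof.
move=> muX; apply/set0P/eqP => X0; have := muX; rewrite X0 measure0 => /eqP.
by rewrite eq_sym onee_eq0.
Qed.

Section bounded_functions.
Context d (T : measurableType d) (R : realType) (mu : probability T R).
Variable X : set T.
Hypotheses (mX : measurable X) (muX : mu X = 1%E).
Implicit Types f g : T -> R.

(** For a probability measure these functions are integrable, and the class is stable under all
    operations used below, so it replaces the integrability side conditions. *)
Definition bounded_measurable f :=
  measurable_fun X f /\ exists B, forall x, X x -> `|f x| <= B.

Lemma bounded_measurable_integrable f : bounded_measurable f ->
  mu.-integrable X (EFin \o f).
Proof.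
move=> [mf [B fB]]; apply: measurable_bounded_integrable => //.
  by rewrite -ge0_fin_numE// fin_num_measure.
by exists B; split=> [|M BM x Xx]; [exact: num_real|exact: le_trans (fB _ Xx) (ltW BM)].
Qed.

Lemma bounded_measurable_cst r : bounded_measurable (fun=> r).
Proof. by split; [exact: measurable_cst|exists `|r|]. Qed.

Lemma bounded_measurableD f g : bounded_measurable f -> bounded_measurable g ->
  bounded_measurable (fun x => f x + g x).
Proof.
move=> [mf [B fB]] [mg [C gC]]; split; first exact: measurable_funD.
exists (B + C) => x Xx; apply: le_trans (ler_normD _ _) _.
by rewrite lerD// ?fB ?gC.
Qed.

Lemma bounded_measurableZ r f : bounded_measurable f ->
  bounded_measurable (fun x => r * f x).
Proof.
move=> [mf [B fB]]; split; first exact: measurable_funM.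
by exists (`|r| * B) => x Xx; rewrite normrM ler_wpM2l// fB.
Qed.

Lemma bounded_measurable_sum (I : Type) (s : seq I) (F : I -> T -> R) :
  (forall i, bounded_measurable (F i)) ->
  bounded_measurable (fun x => \sum_(i <- s) F i x).
Proof.
move=> h; elim: s => [|i s IH].
  by under eq_fun do rewrite big_nil; exact: bounded_measurable_cst.
by under eq_fun do rewrite big_cons; exact: bounded_measurableD.
Qed.

Lemma bounded_Rintegral_cst r : \int[mu]_(x in X) r = r.
Proof.
transitivity (r * fine (mu X)); first exact: Rintegral_cst.
by rewrite muX mulr1.
Qed.

Lemma bounded_RintegralD f g : bounded_measurable f -> bounded_measurable g ->
  \int[mu]_(x in X) (f x + g x) = \int[mu]_(x in X) f x + \int[mu]_(x in X) g x.
Proof. by move=> bf bg; rewrite RintegralD//; exact: bounded_measurable_integrable. Qed.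

Lemma bounded_RintegralZ r f : bounded_measurable f ->
  \int[mu]_(x in X) (r * f x) = r * \int[mu]_(x in X) f x.
Proof. by move=> bf; rewrite RintegralZl//; exact: bounded_measurable_integrable. Qed.

Lemma le_bounded_Rintegral f g : bounded_measurable f -> bounded_measurable g ->
  (forall x, X x -> f x <= g x) ->
  \int[mu]_(x in X) f x <= \int[mu]_(x in X) g x.
Proof.
by move=> bf bg fg; apply: le_Rintegral => //; exact: bounded_measurable_integrable.
Qed.

Lemma bounded_Rintegral_sum (I : Type) (s : seq I) (F : I -> T -> R) :
  (forall i, bounded_measurable (F i)) ->
  \int[mu]_(x in X) (\sum_(i <- s) F i x) = \sum_(i <- s) \int[mu]_(x in X) F i x.
Proof.
move=> h; elim: s => [|i s IH].
  by rewrite big_nil; under eq_Rintegral do rewrite big_nil; exact: bounded_Rintegral_cst.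
under eq_Rintegral do rewrite big_cons.
by rewrite bounded_RintegralD ?IH ?big_cons//; exact: bounded_measurable_sum.
Qed.

Lemma bounded_measurable_indic (D : set T) : measurable D ->
  bounded_measurable (\1_D : T -> R).
Proof.
move=> mD; split; first exact: measurable_indic.
by exists 1 => x _; rewrite indicE; case: (_ \in _); rewrite ?normr1 ?normr0.
Qed.

Lemma Rintegral_indicator (D : set T) : measurable D ->
  \int[mu]_(x in X) \1_D x = fine (mu (D `&` X)).
Proof. by move=> mD; rewrite /Rintegral integral_indic. Qed.

Section invariance.
Variable S : T -> T.
Hypotheses (mS : measurable_fun setT S) (SX : S @^-1` X = X).
Hypothesis muS : forall E, measurable E -> mu (S @^-1` E) = mu E.

Lemma bounded_measurable_comp f :
  bounded_measurable f -> bounded_measurable (f \o S).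
Proof.
move=> [mf [B fB]]; split; last first.
  by exists B => x Xx; apply: fB; rewrite -SX in Xx.
move=> _ Y mY; rewrite comp_preimage -{1}SX -preimage_setI -(setTI (_ @^-1` _)).
by apply: mS => //; exact: mf.
Qed.

Lemma Rintegral_invariant f : bounded_measurable f ->
  \int[mu]_(x in X) f (S x) = \int[mu]_(x in X) f x.
Proof.
(* [f] is measurable only on [X]; its extension by 0 is measurable everywhere, as the change of
   variables requires. *)
move=> bf; pose g : T -> \bar R := (EFin \o f) \_ X.
have mg : measurable_fun setT g.
  apply/measurable_restrict => //; rewrite setTI; apply/measurable_EFinP.
  exact: bf.1.
have gS : {in X, (EFin \o f) \o S =1 g \o S}.
  move=> x /set_mem; rewrite -{1}SX => Xx; rewrite /g /= patchE mem_set//.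
rewrite /Rintegral; congr fine.
have -> : (\int[mu]_(x in X) (f x)%:E = \int[mu]_(x in X) g x)%E.
  by apply: eq_integral => x xX; rewrite /g patchE xX.
transitivity (\int[mu]_(x in X) (g \o S) x)%E.
  by apply: eq_integral => x xX; exact: gS.
have := @integral_pushforward _ _ _ _ R S mS mu X g mg.
rewrite SX => <-//.
  by apply: eq_measure_integral => E mE _; rewrite /= /pushforward muS.
apply: (@eq_integrable _ _ _ mu X mX ((EFin \o f) \o S)); first exact: gS.
by apply: (@bounded_measurable_integrable (f \o S)); exact: bounded_measurable_comp.
Qed.

End invariance.

Section fibers.
Variables (J : finType) (g : T -> J).
Hypothesis mg : forall j, measurable (X `&` [set x | g x = j]).

(** The law of [g] under [mu]. Partitions enter the entropy estimates as the fibres of maps into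
    finite types. *)
Definition fiber_prob j : R := fine (mu (X `&` [set x | g x = j])).

Lemma fiber_prob_ge0 j : 0 <= fiber_prob j.
Proof. exact: fine_ge0. Qed.

Lemma bounded_measurable_fiber (F : J -> R) : bounded_measurable (F \o g).
Proof.
split.
  move=> _ Y mY; have -> : X `&` (F \o g) @^-1` Y =
      \bigcup_(j in [set j | Y (F j)]) (X `&` [set x | g x = j]).
    apply/seteqP; split=> [x [Xx Yx]|x [j Yj [Xx /= gx]]]; first by exists (g x).
    by split; rewrite //= gx.
  exact: fin_bigcup_measurable.
exists (\sum_j `|F j|) => x _ /=.
by rewrite (bigD1 (g x))//= lerDl sumr_ge0.
Qed.

Lemma Rintegral_fiber (F : J -> R) :
  \int[mu]_(x in X) F (g x) = \sum_j F j * fiber_prob j.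
Proof.
have -> : \int[mu]_(x in X) F (g x) =
    \int[mu]_(x in X) (\sum_j F j * \1_(X `&` [set x | g x = j]) x).
  apply: eq_Rintegral => x /set_mem Xx; rewrite (bigD1 (g x))//= big1 ?addr0.
    by rewrite indicE mem_set// mulr1.
  move=> j jg; rewrite indicE memNset ?mulr0// => -[_ /= gx].
  by rewrite gx eqxx in jg.
rewrite bounded_Rintegral_sum => [|j]; last first.
  by apply: bounded_measurableZ; exact: bounded_measurable_indic.
apply: eq_bigr => j _; rewrite bounded_RintegralZ; last exact: bounded_measurable_indic.
by rewrite Rintegral_indicator// setIAC setIid.
Qed.

Lemma fiber_prob_sum1 : \sum_j fiber_prob j = 1.
Proof.
have := Rintegral_fiber (fun=> 1); rewrite bounded_Rintegral_cst => ->.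
by apply: eq_bigr => j _; rewrite mul1r.
Qed.

End fibers.
End bounded_functions.

(** This is ln t <= t - 1 at t = q / p, multiplied by [p]. Summed over a probability [p] and a
    subprobability [q], the corrections [q - p] have a nonpositive total. *)
Lemma entropy_fun_cross (R : realType) (p q : R) : 0 <= p -> 0 < q ->
  entropy_fun p <= p * - ln q + (q - p).
Proof.
rewrite le_eqVlt => /predU1P[<- q0|p0 q0].
  by rewrite /entropy_fun !mul0r oppr0 addr0 add0r ltW.
have h : ln (q / p) <= q / p - 1.
  by rewrite -lerBlDr opprK addrC (le_trans (expR_ge1Dx _))// lnK ?posrE ?divr_gt0.
rewrite ln_div// in h.
have := ler_wpM2l (ltW p0) h; rewrite /entropy_fun.
have -> : p * (q / p - 1) = q - p by rewrite mulrBr mulr1 mulrC divfK// gt_eqF.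
by lra.
Qed.

Section joint_entropy.
Context d (T : measurableType d) (R : realType) (mu : probability T R).
Variable X : set T.
Hypotheses (mX : measurable X) (muX : mu X = 1%E).
Variables (J K : finType) (g : T -> J) (h : T -> K).
Hypothesis mg : forall j, measurable (X `&` [set x | g x = j]).
Hypothesis mh : forall j, measurable (X `&` [set x | h x = j]).

Lemma measurable_pair_fiber t : measurable (X `&` [set x | (g x, h x) = t]).
Proof.
have -> : X `&` [set x | (g x, h x) = t] =
    (X `&` [set x | g x = t.1]) `&` (X `&` [set x | h x = t.2]).
  case: t => j k; apply/seteqP; split=> x /=; first by case=> Xx [<- <-].
  by case=> -[Xx <-] [_ <-].
exact: measurableI.
Qed.

(* The entropy of g is at most that of (g, h), hence at most the cross entropy
   of (g, h) relative to any subprobability q. *)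
Lemma entropy_le_cross (q : J * K -> R) : (forall t, 0 <= q t) ->
  (forall x, X x -> 0 < q (g x, h x)) -> \sum_t q t <= 1 ->
  \sum_j entropy_fun (fiber_prob mu X g j) <=
  \int[mu]_(x in X) (- ln (q (g x, h x))).
Proof.
move=> q0 qX q1; pose gh x := (g x, h x).
have mgh : forall t, measurable (X `&` [set x | gh x = t]) := measurable_pair_fiber.
pose p t := fiber_prob mu X gh t.
have pgh t : p t <= fiber_prob mu X g t.1.
  rewrite fine_le// ?fin_num_measure// le_measure ?inE//.
  by apply: setIS => x /= <-.
rewrite (Rintegral_fiber mX muX mgh (fun t => - ln (q t))).
have -> : \sum_j entropy_fun (fiber_prob mu X g j) =
    \sum_t - ln (fiber_prob mu X g t.1) * p t.
  rewrite -(Rintegral_fiber mX muX mgh (fun t => - ln (fiber_prob mu X g t.1))).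
  rewrite (Rintegral_fiber mX muX mg (fun j => - ln (fiber_prob mu X g j))).
  by apply: eq_bigr => j _; rewrite /entropy_fun; lra.
apply: (@le_trans _ _ (\sum_t entropy_fun (p t))).
  apply: ler_sum => t _; rewrite /entropy_fun.
  have := fiber_prob_ge0 mu X gh t; rewrite -/(p t) le_eqVlt => /predU1P[<-|p0].
    by rewrite mulr0 mul0r oppr0.
  rewrite mulNr mulrC lerN2 ler_wpM2l ?(ltW p0)// ler_ln ?posrE//.
  exact: lt_le_trans (pgh t).
apply: (@le_trans _ _ (\sum_t (- ln (q t) * p t + (q t - p t)))).
  apply: ler_sum => t _.
  have := fiber_prob_ge0 mu X gh t; rewrite -/(p t) le_eqVlt => /predU1P[<-|p0].
    by rewrite /entropy_fun mul0r mulr0 oppr0 add0r addr0.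
  rewrite mulrC; apply: entropy_fun_cross; first exact: ltW.
  (* Positivity of [q] is known only at attained values; a value of positive probability is
     attained. *)
  have [[x [Xx <-]]|nx] := pselect (exists x, X x /\ gh x = t); first exact: qX.
  move: p0; rewrite /p /fiber_prob (_ : X `&` _ = set0) ?measure0 ?ltxx//.
  by rewrite -subset0 => x [Xx gx]; case: nx; exists x.
rewrite big_split /= sumrB (fiber_prob_sum1 mX muX mgh).
by rewrite gerDl subr_le0.
Qed.

End joint_entropy.

(** * Approximation of Borel sets by local sets *)

Section approximation.
Variables (R : realType) (A : alphabetType) (mu : probability (full_shift A) R).
Implicit Types E C : set (full_shift A).

Definition approximable E := measurable E /\ forall e : R, 0 < e ->
  exists N C, local_set N C /\ (mu ((E `\` C) `|` (C `\` E)) < e%:E)%E.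

Lemma sdiff_measurable E C : measurable E -> measurable C ->
  measurable ((E `\` C) `|` (C `\` E)).
Proof. by move=> mE mC; apply: measurableU; exact: measurableD. Qed.

Lemma measure_cover2 E E1 E2 : measurable E -> measurable E1 -> measurable E2 ->
  E `<=` E1 `|` E2 -> (mu E <= mu E1 + mu E2)%E.
Proof.
move=> mE m1 m2 h; apply: (@le_trans _ _ (mu (E1 `|` E2))); last exact: measureU2.
by apply: le_measure; rewrite ?inE//; exact: measurableU.
Qed.

Lemma increasing_exhaust (F : nat -> set (full_shift A)) (e : R) :
  (forall n, measurable (F n)) -> nondecreasing_seq F -> 0 < e ->
  exists n, (mu ((\bigcup_n F n) `\` F n) < e%:E)%E.
Proof.
move=> mF ndF e0; pose G n := (\bigcup_n F n) `\` F n.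
have mU : measurable (\bigcup_n F n) by exact: bigcup_measurable.
have mG n : measurable (G n) by exact: measurableD.
have G0 : \bigcap_n G n = set0.
  rewrite -subset0 => x Gx; have [[m _ Fx] _] := Gx 0%N I.
  by have [_] := Gx m I.
have : mu \o G @ \oo --> mu (\bigcap_n G n).
  apply: nonincreasing_cvg_mu => //.
  - by rewrite -ge0_fin_numE// fin_num_measure.
  - by rewrite G0.
  - move=> m n mn; apply/subsetPset => x [Ux nFx]; split=> // Fx.
    by apply: nFx; move/subsetPset: (ndF _ _ mn); apply.
rewrite G0 measure0 => /fine_cvg/cvgr_lt/(_ _ e0)[n _ /(_ n (leqnn n))/= h].
exists n; rewrite -lte_fin fineK// in h.
exact: fin_num_measure.
Qed.

Lemma approximableU E1 E2 : approximable E1 -> approximable E2 ->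
  approximable (E1 `|` E2).
Proof.
move=> [m1 a1] [m2 a2]; split=> [|e e0]; first exact: measurableU.
have e2 : 0 < e / 2 by rewrite divr_gt0.
have [N1 [C1 [l1 h1]]] := a1 _ e2; have [N2 [C2 [l2 h2]]] := a2 _ e2.
have l1' := local_set_le (leq_maxl N1 N2) l1.
have l2' := local_set_le (leq_maxr N1 N2) l2.
exists (maxn N1 N2), (C1 `|` C2); split.
  by move=> x y xy [Cx|Cx]; [left; exact: l1' Cx|right; exact: l2' Cx].
have mC1 := measurable_local l1; have mC2 := measurable_local l2.
rewrite (splitr e) EFinD; apply: le_lt_trans (lteD h1 h2).
apply: measure_cover2.
- by apply: sdiff_measurable; exact: measurableU.
- exact: sdiff_measurable.
- exact: sdiff_measurable.
- by move=> x /=; tauto.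
Qed.

(** A finite partial union already fills the whole union up to measure e / 2, and finite unions are
    approximable. *)
Lemma approximable_bigcup (F : nat -> set (full_shift A)) :
  (forall n, approximable (F n)) -> approximable (\bigcup_n F n).
Proof.
move=> aF; pose G n := \big[setU/set0]_(i < n.+1) F i.
have aG n : approximable (G n).
  rewrite /G; elim/big_ind: _ => //; last exact: approximableU.
  split=> // e e0; exists 0%N, set0; split=> //.
  by rewrite setDv setU0 measure0 lte_fin.
have UG : \bigcup_n G n = \bigcup_n F n by rewrite bigcup_bigsetU_bigcup.
split=> [|e e0]; first by apply: bigcup_measurable => n _; exact: (aF n).1.
have e2 : 0 < e / 2 by rewrite divr_gt0.
have mG n : measurable (G n) by exact: (aG n).1.
have [n hn] : exists n, (mu ((\bigcup_n G n) `\` G n) < (e / 2)%:E)%E.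
  apply: increasing_exhaust => // m n mn; apply/subsetPset.
  exact: subset_bigsetU.
have [N [C [lC hC]]] := (aG n).2 _ e2.
exists N, C; split => //; have mC := measurable_local lC.
have mU : measurable (\bigcup_n G n) by exact: bigcup_measurable.
rewrite (splitr e) EFinD; apply: le_lt_trans (lteD hn hC); rewrite -UG.
apply: measure_cover2;
  [exact: sdiff_measurable|exact: measurableD|exact: sdiff_measurable|].
move=> x /= [[Ux nCx]|[Cx nUx]].
  by have [Gx|nGx] := pselect (G n x); [right; left|left].
by right; right; split=> // Gx; apply: nUx; exists n.
Qed.

(** The approximable sets form a sigma-algebra, and an open set is the increasing union of the local
    sets [F N] of points whose central [N]-cylinder lies inside it. *)
Lemma measurable_approximable E : measurable E -> approximable E.
Proof.
suff : <<s @open (full_shift A) >> `<=` approximable by exact.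
apply: smallest_sub; first split.
- split=> // e e0; exists 0%N, set0; split=> //.
  by rewrite setDv setU0 measure0 lte_fin.
- move=> B [mB aB]; rewrite setTD; split=> [|e e0]; first exact: measurableC.
  have [N [C [lC hC]]] := aB _ e0; exists N, (~` C); split; first exact: local_setC.
  by rewrite !setDE !setCK setUC (setIC _ B) (setIC _ C) -!setDE.
- exact: approximable_bigcup.
move=> U oU; split=> [|e e0]; first exact: measurable_open.
pose F N : set (full_shift A) := [set x | agree N x `<=` U].
have lF N : local_set N (F N).
  by move=> x y xy Fx z yz; apply: Fx; exact: agree_trans yz.
have UF : U = \bigcup_N F N.
  apply/seteqP; split=> [x Ux|x [N _ Fx]]; last exact: Fx.
  by have [N NU] := (full_shift_openP U).1 oU x Ux; exists N.
have [N hN] : exists N, (mu ((\bigcup_N F N) `\` F N) < e%:E)%E.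
  apply: increasing_exhaust => // [N|m n mn]; first exact: measurable_local (lF N).
  by apply/subsetPset => x Fx y /(agree_le mn); exact: Fx.
exists N, (F N); split=> //; rewrite -UF in hN.
suff -> : F N `\` U = set0 by rewrite setU0.
by rewrite -subset0 => x [Fx]; apply; exact: Fx.
Qed.

(** Each [P i] is approximated by a local [C i] within e / k. The [C i] may overlap or fail to
    cover, so [Q] picks some [i] with [C i x], or else [i0]. Off the union [D] of the symmetric
    differences, [C i] and [P i] coincide for all [i] at once. *)
Lemma local_index k (i0 : 'I_k) (P : 'I_k -> set (full_shift A)) (e : R) :
  trivIset setT P -> (forall i, measurable (P i)) -> 0 < e ->
  exists N (Q : full_shift A -> 'I_k) (D : set (full_shift A)),
  [/\ forall x y, agree N x y -> Q x = Q y, measurable D, (mu D <= e%:E)%E &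
      forall i x, P i x -> ~ D x -> Q x = i].
Proof.
move=> tP mP e0; pose e' := e / k%:R.
have k0 : (0 < k)%N by exact: leq_ltn_trans (ltn_ord i0).
have e'0 : 0 < e' by rewrite divr_gt0// ltr0n.
have /choice[t tP'] i : exists t : nat * set (full_shift A),
    local_set t.1 t.2 /\ (mu ((P i `\` t.2) `|` (t.2 `\` P i)) < e'%:E)%E.
  by have [N [C ?]] := (measurable_approximable (mP i)).2 _ e'0; exists (N, C).
pose N := (\max_i (t i).1)%N; pose C i := (t i).2.
have lC i : local_set N (C i).
  by apply: local_set_le (tP' i).1; exact: (leq_bigmax i).
pose D := \big[setU/set0]_(i < k) ((P i `\` C i) `|` (C i `\` P i)).
exists N, (fun x => odflt i0 [pick i | `[< C i x >]]), D.
have [mD muD] : measurable D /\ (mu D <= (\sum_(i < k) e')%:E)%E.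
  rewrite /D; elim/big_ind2: _ => [|D1 r1 D2 r2 [m1 h1] [m2 h2]|i _].
  - by rewrite measure0.
  - split; first exact: measurableU.
    by rewrite EFinD; apply: le_trans (measureU2 _ _ _) _ => //; exact: leeD.
  - split; last exact: ltW (tP' i).2.
    by apply: sdiff_measurable => //; exact: measurable_local (lC i).
split=> //.
- move=> x y xy; congr odflt; apply: eq_pick => i.
  by apply/asboolP/asboolP; apply: lC => //; exact: agree_sym.
- apply: le_trans muD _; rewrite lee_fin sumr_const card_ord -(mulr_natr e').
  by rewrite /e' divfK// pnatr_eq0 -lt0n.
- move=> i x Pix nDx.
  have PC j : P j x <-> C j x.
    split=> h; apply: contrapT => nh; apply: nDx;
      rewrite /D (bigD1 j)//=; left; by [left|right].
  case: pickP => /= [j /asboolP/PC Pj|/(_ i)/asboolP []]; last exact/PC.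
  by apply: (tP j i) => //; exists x.
Qed.

End approximation.

(** * Bounded distortion *)

(** Domination of the tail by [w] gives absolute convergence, so that [limn] is a genuine limit, and
    bounds the tail below by [- V]. *)
Lemma lim_series_ge (R : realType) (u w : nat -> R) (V : R) (L : nat) :
  (forall n, \sum_(0 <= k < n) w k <= V) -> (forall k, `|u (L + k)%N| <= w k) ->
  \sum_(0 <= n < L) u n - V <= limn (series u).
Proof.
move=> wV uw.
have tail n : (L <= n)%N -> \sum_(L <= k < n) `|u k| <= V.
  move=> Ln; apply: le_trans (wV (n - L)%N).
  rewrite -{1}(add0n L) -{1}(subnK Ln) big_addn addnK.
  by apply: ler_sum => k _; rewrite addnC.
have V0 : 0 <= V by have := wV 0%N; rewrite big_geq.
apply: limr_ge.
  suff : cvgn (series (fun n => `|u n|)) by exact: normed_cvg.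
  apply: nondecreasing_is_cvgn.
    by apply/nondecreasing_seqP => n; rewrite -subr_ge0 seriesSB /=.
  exists (\sum_(0 <= n < L) `|u n| + V) => _ [n _ <-]; rewrite seriesEnat /=.
  have [nL|Ln] := leqP n L; last first.
    by rewrite (big_cat_nat (leq0n L) (ltnW Ln))/= lerD2l tail// ltnW.
  by rewrite (big_cat_nat (leq0n n) nL)/= -addrA lerDl addr_ge0// sumr_ge0.
exists L => // n /= Ln.
rewrite seriesEnat /= (big_cat_nat (leq0n L) Ln)/= lerD2l lerNl.
by apply: le_trans (tail n Ln); rewrite -sumrN; apply: ler_sum => k _;
  rewrite -normrN ler_norm.
Qed.

Section potential.
Variables (R : realType) (A : alphabetType).
Variables (X : set (full_shift A)) (f : full_shift A -> R).
Hypotheses (sX : is_shift_space X) (fSV : summable_variation X f).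
Implicit Types x y z : full_shift A.

Lemma potential_bounded : exists B, forall x, X x -> `|f x| <= B.
Proof.
have cX : compact X by apply: subclosed_compact sX.1 (@full_shift_compact A) _.
have /compact_bounded[M [_ MB]] := continuous_compact fSV.1 cX.
by exists (M + 1) => x Xx; apply: (MB (M + 1)); [rewrite ltrDl|exists x].
Qed.

Lemma measurable_shift_space : measurable X.
Proof. exact: measurable_closed sX.1. Qed.

Lemma potential_measurable : measurable_fun X f.
Proof.
move=> mX; move: mX => _; move/continuousP: fSV.1 => cf.
apply: (measurability _ (RGenOpens.measurableE R)) => [_ [_ [a [b ->] <-]]|].
  have /cf/open_subspaceP[U oU UX] : open `]a, b[%classic.
    exact: interval_open.
  rewrite setIC -UX setIC; apply: measurableI; first exact: measurable_shift_space.
  exact: measurable_open.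
exact: measurable_shift_space.
Qed.

Lemma osc_ub k x y : X x -> X y ->
  (forall n : int, (`|n| <= k)%N -> x n = y n) -> `|f x - f y| <= osc X f k.
Proof.
move=> Xx Xy xy; have [B fB] := potential_bounded.
apply: ub_le_sup; last by exists x, y.
exists (B + B) => _ [x' [y' [Xx' Xy' _ ->]]].
by apply: le_trans (ler_normB _ _) _; rewrite lerD ?fB.
Qed.

Lemma osc_ge0 k : 0 <= osc X f k.
Proof.
have [[x Xx]|X0] := pselect (exists x, X x).
  by have := osc_ub (k := k) Xx Xx (fun _ _ => erefl); rewrite subrr normr0.
rewrite /osc (_ : [set _ | _] = set0) ?sup0// -subset0 => r [x [y [Xx]]].
by case: X0; exists x.
Qed.

Lemma osc_summable : exists V, forall n, \sum_(0 <= k < n) osc X f k <= V.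
Proof.
have /cvg_seq_bounded/bounded_fun_has_ubound[V VB] := fSV.2.
exists V => n; have : series (potential_var X f) n.+1 <= V by apply: VB; exists n.+1.
rewrite seriesEnat /= big_nat_recl//=; apply: le_trans; rewrite lerDr.
rewrite /sup_norm; have [[x Xx]|X0] := pselect (exists x, X x).
  apply: (@le_trans _ _ `|f x|) => //; have [B fB] := potential_bounded.
  by apply: ub_le_sup; [exists B => _ [y Xy <-]; exact: fB|exists x].
by rewrite (_ : image _ _ = set0) ?sup0// -subset0 => r [x Xx]; case: X0; exists x.
Qed.

Definition birkhoff n x : R := \sum_(0 <= i < n) f (shift_map i%:Z x).

Lemma shift_space_shift n x : X x -> X (shift_map n x).
Proof. exact: sX.2. Qed.

(** At time [i] the shifted points agree on the window whose radius is the smaller of [i] and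
    [n - i.+1]. Bounding the oscillation by the sum of those for both radii gives two sums, each at
    most the total variation. *)
Lemma birkhoff_distortion : exists V, forall n x y, X x -> X y ->
  (forall i : nat, (i < n)%N -> x i%:Z = y i%:Z) ->
  birkhoff n x <= birkhoff n y + V.
Proof.
have [V VB] := osc_summable; exists (V + V) => n x y Xx Xy xy.
rewrite -lerBlDl /birkhoff -sumrB.
apply: (@le_trans _ _ (\sum_(0 <= i < n) (osc X f i + osc X f (n - i.+1)%N))).
  apply: ler_sum_nat => i /andP[_ ilt]; apply: le_trans (ler_norm _) _.
  have [ij|ji] := leqP i (n - i.+1).
    apply: (@le_trans _ _ (osc X f i)); last by rewrite lerDl osc_ge0.
    apply: osc_ub => [||m mi]; [exact: shift_space_shift..|].
    rewrite /shift_map; have -> : (m + i%:Z = (absz (m + i%:Z))%:Z)%R by lia.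
    by apply: xy; lia.
  apply: (@le_trans _ _ (osc X f (n - i.+1))); last by rewrite lerDr osc_ge0.
  apply: osc_ub => [||m mi]; [exact: shift_space_shift..|].
  rewrite /shift_map; have -> : (m + i%:Z = (absz (m + i%:Z))%:Z)%R by lia.
  by apply: xy; lia.
rewrite big_split /= lerD// big_nat_rev /= add0n.
rewrite (eq_big_nat _ _ (F2 := osc X f))// => i /andP[_ ilt].
by congr osc; lia.
Qed.

Lemma birkhoff_bounded : exists B, 0 <= B /\
  forall n x, X x -> `|birkhoff n x| <= B * n%:R.
Proof.
have [B fB] := potential_bounded; exists `|B|; split=> // n x Xx.
apply: le_trans (ler_norm_sum _ _ _) _; apply: (@le_trans _ _ (\sum_(0 <= i < n) `|B|)).
  apply: ler_sum => i _; apply: le_trans (ler_norm B).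
  by apply: fB; exact: shift_space_shift.
by rewrite big_const_nat iter_addr_0 subn0 mulr_natr.
Qed.

Lemma birkhoffD m n x : birkhoff (m + n) x =
  birkhoff m x + birkhoff n (shift_map m%:Z x).
Proof.
rewrite /birkhoff (big_cat_nat (leq0n m) (leq_addr n m))/=; congr (_ + _).
rewrite -{1}(add0n m) big_addn addKn; apply: eq_bigr => i _; congr f.
by apply/funext => k; rewrite /shift_map; congr x; lia.
Qed.

(** The terms with index in [0, L) give the Birkhoff sums exactly. At distance [k] beyond either end
    of that window the two shifted points agree on [-k, k], so each of the two tails costs at most
    the total variation. *)
Lemma cocycle_ge : exists V, forall L x z, X x -> X z ->
  (forall i : int, i < 0 \/ L%:Z <= i -> x i = z i) ->
  birkhoff L z - birkhoff L x - V <= cocycle_of f x z.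
Proof.
have [V VB] := osc_summable; exists (V + V) => L x z Xx Xz xz.
pose d (n : int) := f (shift_map n z) - f (shift_map n x).
have pos : birkhoff L z - birkhoff L x - V <= limn (series (fun n : nat => d n%:Z)).
  rewrite /birkhoff -sumrB; apply: (lim_series_ge VB) => k.
  apply: osc_ub => [||m mk]; [exact: shift_space_shift..|].
  by rewrite /shift_map xz//; right; lia.
have neg : - V <= limn (series (fun n : nat => d (- n.+1%:Z))).
  have := @lim_series_ge _ (fun n => d (- n.+1%:Z)) (osc X f) V 0 VB.
  rewrite big_geq// sub0r; apply => k; rewrite add0n.
  apply: osc_ub => [||m mk]; [exact: shift_space_shift..|].
  by rewrite /shift_map xz//; left; lia.
by apply: le_trans (lerD pos neg); rewrite opprD addrA.
Qed.

End potential.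

(** * Splicing words in an irreducible shift of finite type *)

Section words.
Variable A : alphabetType.
Implicit Types x y : full_shift A.

Definition state (m : nat) x (n : int) : {ffun 'I_m -> A} :=
  [ffun i : 'I_m => x (n + (i : nat)%:Z)].

Lemma state_eqP m x n y k :
  state m x n = state m y k <->
  (forall i : nat, (i < m)%N -> x (n + i%:Z) = y (k + i%:Z)).
Proof.
split=> [/ffunP h i im|h]; first by have := h (Ordinal im); rewrite !ffunE.
by apply/ffunP => i; rewrite !ffunE h.
Qed.

Lemma state_shift m (n : int) x k : state m (shift_map n x) k = state m x (k + n).
Proof. by apply/ffunP => i; rewrite !ffunE /shift_map; congr x; lia. Qed.

End words.

Section subshift_of_finite_type.
Variables (A : alphabetType) (X : set (full_shift A)).
Hypotheses (sX : is_shift_space X) (iX : is_irreducible X).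
Variable M : nat.
Hypothesis M0 : (0 < M)%N.
(** The Markov property with memory [M]: it stands for the list of forbidden words from here on. *)
Hypothesis glueX : forall (i : int) (x y : full_shift A), X x -> X y ->
  (forall k : int, i <= k < i + M%:Z -> x k = y k) ->
  exists z : full_shift A, [/\ X z, forall k : int, k < i + M%:Z -> z k = x k &
    forall k : int, i <= k -> z k = y k].
Implicit Types x y z : full_shift A.

(** Walks in the higher block graph, whose vertices are the [M]-blocks of [X]; a word of length
    [n + M] is a walk of length [n]. *)
Definition transition n (a b : {ffun 'I_M -> A}) :=
  exists x, [/\ X x, state M x 0 = a & state M x n%:Z = b].

Definition valid_state (a : {ffun 'I_M -> A}) := exists x, X x /\ state M x 0 = a.

Lemma transition_valid n a b : transition n a b -> valid_state a /\ valid_state b.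
Proof.
move=> [x [Xx xa xb]]; split; first by exists x.
by exists (shift_map n%:Z x); rewrite state_shift add0r; split=> //; exact: sX.2.
Qed.

Lemma transition_cat m n a b c :
  transition m a b -> transition n b c -> transition (m + n) a c.
Proof.
move=> [x [Xx xa xb]] [y [Xy yb yc]].
have [|z [Xz zx zy]] := glueX (i := m%:Z) Xx (sX.2 (- m%:Z) _ Xy).
  move=> k /andP[mk kM]; have -> : k = m%:Z + (absz (k - m%:Z))%:Z by lia.
  rewrite -yb in xb; have /state_eqP -> := xb; last by lia.
  by rewrite /shift_map; congr y; lia.
exists z; split=> //.
  by rewrite -xa; apply/state_eqP => i iM; apply: zx; lia.
rewrite -yc; apply/state_eqP => i iM; rewrite zy; last by lia.
by rewrite /shift_map; congr y; lia.
Qed.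

Lemma transition_irreducible a b : valid_state a -> valid_state b ->
  exists2 k, (0 < k)%N & transition k a b.
Proof.
move=> [x [Xx xa]] [y [Xy yb]].
have lw z : X z -> language X (window z 0 M).
  by move=> Xz; exists z => //; exists 0; rewrite size_mkseq.
have [w _ [z Xz [i zi]]] := iX (lw _ Xx) (lw _ Xy).
exists (M + size w)%N; first by lia.
have zE (j : nat) : (j < M + (size w + M))%N -> z (i + j%:Z) =
    nth point (window x 0 M ++ w ++ window y 0 M) j.
  move=> jlt; rewrite -zi !size_cat !size_mkseq nth_mkseq//.
exists (shift_map i z); rewrite !state_shift; split; first exact: sX.2.
  rewrite -xa; apply/state_eqP => j jM; rewrite add0r zE; last by lia.
  by rewrite nth_cat size_mkseq jM nth_mkseq.
rewrite -yb; apply/state_eqP => j jM.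
have -> : (M + size w)%N%:Z + i + j%:Z = i + (M + size w + j)%N%:Z by lia.
rewrite zE; last by lia.
have wxM : size (window x 0 M) = M by rewrite size_mkseq.
rewrite nth_cat wxM ifF; last by lia.
by rewrite -addnA addKn nth_cat ifF ?addKn ?nth_mkseq// ltnNge leq_addr.
Qed.

(** The word of [y] replaces the middle of a window of [x] of length [n + T.*2], and
    [uniform_connection] supplies the links on both sides. The total slack is independent of [n] and
    of the words; only the offset [j] varies. *)
Lemma splice : exists T, forall n x y, (M <= n)%N -> X x -> X y ->
  exists (j : nat) z, [/\ (j <= T.*2)%N, X z,
    forall k : int, k < M%:Z \/ (n + T.*2 - M)%N%:Z <= k -> z k = x k &
    forall i : nat, (i < n)%N -> z (j%:Z + i%:Z) = y i%:Z].
Proof.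
have [T TP] := uniform_connection transition_valid transition_cat
  transition_irreducible.
exists T => n x y Mn Xx Xy; pose n' := (n - M)%N.
have Ex : transition (n' + T.*2) (state M x 0) (state M x (n' + T.*2)%N%:Z).
  by exists x.
have Ey : transition n' (state M y 0) (state M y n'%:Z) by exists y.
have [j jT [[u1 [Xu1 u10 u1j]] [u2 [Xu2 u20 u2j]]]] := TP _ _ _ _ _ Ex Ey.
move/state_eqP in u10; move/state_eqP in u1j.
move/state_eqP in u20; move/state_eqP in u2j.
(* The points x, u1, y, u2, x are glued in this order along the [M]-blocks at 0, [j], [j + n'] and
   [n' + T.*2]. *)
have [|z1 [Xz1 z1x z1u]] := glueX (i := 0) Xx Xu1.
  move=> k kM; have -> : k = 0 + (absz k)%:Z by lia.
  by rewrite u10//; lia.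
have [|z2 [Xz2 z2z z2y]] := glueX (i := j%:Z) Xz1 (sX.2 (- j%:Z) _ Xy).
  move=> k kM; rewrite z1u; last by lia.
  have -> : k = j%:Z + (absz (k - j%:Z))%:Z by lia.
  by rewrite u1j; [rewrite /shift_map; congr y; lia|lia].
have [|z3 [Xz3 z3z z3u]] := glueX (i := (j + n')%N%:Z) Xz2 (sX.2 (- (j + n')%N%:Z) _ Xu2).
  move=> k kM; rewrite z2y; last by lia.
  have -> : k = (j + n')%N%:Z + (absz (k - (j + n')%N%:Z))%:Z by lia.
  rewrite /shift_map; set i := absz _.
  have -> : (j + n')%N%:Z + i%:Z - j%:Z = n'%:Z + i%:Z by lia.
  have -> : (j + n')%N%:Z + i%:Z - (j + n')%N%:Z = 0 + i%:Z by lia.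
  by rewrite u20//; lia.
have [|z [Xz zz zx]] := glueX (i := (n' + T.*2)%N%:Z) Xz3 Xx.
  move=> k kM; rewrite z3u; last by lia.
  have -> : k = (n' + T.*2)%N%:Z + (absz (k - (n' + T.*2)%N%:Z))%:Z by lia.
  rewrite /shift_map; set i := absz _.
  have -> : (n' + T.*2)%N%:Z + i%:Z - (j + n')%N%:Z = (T.*2 - j)%N%:Z + i%:Z by lia.
  by rewrite u2j//; lia.
exists j, z; split=> //.
  move=> k [kM|kM]; last by apply: zx; lia.
  by rewrite zz ?z3z ?z2z ?z1x//; lia.
move=> i iin; rewrite zz; last by lia.
rewrite z3z; last by lia.
by rewrite z2y; [rewrite /shift_map; congr y; lia|lia].
Qed.

End subshift_of_finite_type.

(** [M] exceeds the length of every forbidden word, so an occurrence of one in the glued point would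
    lie entirely in the part copied from [x] or in the part copied from [y]. *)
Lemma sft_glue (A : alphabetType) (X : set (full_shift A)) : is_sft X ->
  exists2 M : nat, (0 < M)%N & forall (i : int) (x y : full_shift A), X x -> X y ->
  (forall k : int, i <= k < i + M%:Z -> x k = y k) ->
  exists z : full_shift A, [/\ X z, forall k : int, k < i + M%:Z -> z k = x k &
    forall k : int, i <= k -> z k = y k].
Proof.
move=> [_ [F ->]]; exists (\max_(w <- F) size w).+1 => //; set M := _.+1.
move=> i x y Xx Xy xy.
pose z : full_shift A := fun k => if k < i + M%:Z then x k else y k.
have zx (k : int) : k < i + M%:Z -> z k = x k by move=> h; rewrite /z h.
have zy (k : int) : i <= k -> z k = y k.
  by move=> h; rewrite /z; case: ifPn => // h'; rewrite xy// h.
exists z; split=> // w wF [j zj].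
have wM : (size w < M)%N by rewrite ltnS; exact: (leq_bigmax_seq w).
have windowE u : (forall m : nat, (m < size w)%N -> z (j + m%:Z) = u (j + m%:Z)) ->
    window u j (size w) = w.
  move=> h; rewrite -[RHS]zj; apply/eq_in_map => m.
  by rewrite mem_iota => /andP[_ mw]; rewrite h.
have [ij|ji] := leP i j.
  by apply: (Xy w wF); exists j; apply: windowE => m mw; apply: zy; lia.
by apply: (Xx w wF); exists j; apply: windowE => m mw; apply: zx; lia.
Qed.

(** * Holonomies and the Gibbs inequality *)

Section holonomies.
Variables (R : realType) (A : alphabetType) (X : set (full_shift A)).
Hypothesis mX : measurable X.
Implicit Types x y z : full_shift A.

(** A point of [X] is in the saturation exactly when overwriting some central window by some word
    moves it into [E]: a countable union of preimages under continuous maps. *)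
Lemma measurable_saturation (E : set (full_shift A)) : measurable E -> E `<=` X ->
  measurable (saturation X E).
Proof.
move=> mE EX.
pose patch N (w : {ffun 'I_(N.*2.+1) -> A}) (y : full_shift A) : full_shift A :=
  fun k => if (`|k| <= N)%N then w (inord (absz (k + N%:Z))) else y k.
have mpatch N w : measurable_fun setT (@patch N w).
  apply: measurable_fun_full_shift => x m; exists m => y xy n nm.
  by rewrite /patch; case: ifP => // _; exact: xy.
have -> : saturation X E = X `&` \bigcup_N \bigcup_(w in setT) (@patch N w @^-1` E).
  apply/seteqP; split=> [y [x Ex [Xx Xy [N _ xy]]]|y [Xy [N _ [w _ Ew]]]].
    split=> //; exists N => //; exists [ffun i : 'I__ => x ((i : nat)%:Z - N%:Z)] => //.
    rewrite /preimage /= /patch (_ : (fun _ => _) = x)//.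
    apply/funext => k; case: leqP => kN; last by rewrite xy.
    by rewrite ffunE inordK; [congr x; lia|lia].
  exists (patch N w y) => //; split=> //; first exact: EX.
  by exists N.+1 => // n nN; rewrite /patch ifN//; lia.
apply: measurableI => //; apply: bigcup_measurable => N _.
apply: fin_bigcup_measurable => // w _.
by rewrite -(setTI (_ @^-1` _)); exact: mpatch.
Qed.

(** Nonsingularity makes [nu] absolutely continuous, so [mu F] is the integral over [E] of a density
    that is almost everywhere at least [expR c]. *)
Lemma holonomy_measure_ge (phi : full_shift A -> full_shift A -> R)
    (mu : probability (full_shift A) R) E F psi (c : R) :
  is_gibbs_for_cocycle X phi mu -> is_holonomy X E F psi ->
  (forall x, E x -> c <= phi x (psi x)) ->
  ((expR c)%:E * mu E <= mu F)%E.
Proof.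
move=> [_ ns gib] hol cphi; have [[mE EX] [mF FX] [psiEF mpsi mimg] relpsi] := hol.
have [nu [nuE dnu]] := gib _ _ _ hol.
have numu : nu `<< mu.
  apply/null_content_dominatesP => G mG muG0; rewrite nuE//.
  have mGE : measurable (G `&` E) by exact: measurableI.
  have muGE : mu (G `&` E) = 0%E.
    apply/eqP; rewrite eq_le measure_ge0 andbT -muG0.
    by apply: le_measure; rewrite ?inE//; exact: subIsetl.
  have GEX : G `&` E `<=` X by move=> x [_ /EX].
  apply/eqP; rewrite eq_le measure_ge0 andbT -(ns _ mGE GEX muGE).
  apply: le_measure; rewrite ?inE.
  - by apply: mimg => //; exact: subIsetr.
  - exact: measurable_saturation.
  - by move=> _ [x [Gx Ex] <-]; exists x => //; exact: relpsi.
have -> : mu F = nu E.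
  rewrite nuE// setIid; congr (mu _); have [h1 _ h2] := psiEF.
  by apply/seteqP; split=> [y /h2//|_ [x Ex <-]]; exact: h1.
rewrite (Radon_Nikodym_integral numu mE).
have mRN : measurable_fun E ('d nu '/d mu).
  by apply: measurable_funTS; apply: measurable_int; exact: Radon_Nikodym_integrable.
(* The maximum turns the almost sure lower bound on the density into a pointwise one. *)
pose g x := maxe (('d nu '/d mu) x) (expR c)%:E.
have mg : measurable_fun E g by apply: measurable_maxe => //; exact: measurable_cst.
rewrite (@ae_eq_integral _ _ _ mu E g)//; last first.
  move: dnu; apply: filterS => x h Ex; rewrite /g h//; apply/esym/max_idPl.
  by rewrite lee_fin ler_expR cphi.
rewrite -(integral_cst _ mE); apply: ge0_le_integral => //.
- by move=> x _; exact: expR_ge0.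
- by move=> x _; rewrite /g le_max lexx orbT.
Qed.

Definition cyl n x : set (full_shift A) :=
  X `&` [set y | forall i : nat, (i < n)%N -> y i%:Z = x i%:Z].

Lemma measurable_cyl n x : measurable (cyl n x).
Proof.
apply: measurableI => //; apply: (@measurable_local _ n) => y z yz yx i iin.
by rewrite yz; [exact: yx|lia].
Qed.

Variable M : nat.
Hypothesis glueX : forall (i : int) x y, X x -> X y ->
  (forall k : int, i <= k < i + M%:Z -> x k = y k) ->
  exists z, [/\ X z, forall k : int, k < i + M%:Z -> z k = x k &
    forall k : int, i <= k -> z k = y k].

Definition overwrite (L : nat) z y : full_shift A :=
  fun k : int => if (0 <= k) && (k < L%:Z) then z k else y k.

(** [z] and [y] share the first and the last [M] letters of the window, so gluing y, z, y along
    these blocks yields the overwritten point. *)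
Lemma overwrite_cyl L x z y : (M <= L)%N -> X z ->
  (forall k : int, k < M%:Z \/ (L - M)%N%:Z <= k -> z k = x k) ->
  cyl L x y -> cyl L z (overwrite L z y).
Proof.
move=> ML Xz zx [Xy /= yx].
have yxP (k : int) : 0 <= k < L%:Z -> y k = x k.
  by move=> kL; rewrite (_ : k = (absz k)%:Z); [apply: yx; lia|lia].
split; last by move=> i iL; rewrite /overwrite ifT//; lia.
have [|u [Xu uy uz]] := glueX (i := 0) Xy Xz.
  move=> k kM; rewrite zx; last by lia.
  by rewrite yxP//; lia.
have [|v [Xv vu vy]] := glueX (i := (L - M)%N%:Z) Xu Xy.
  move=> k kM; rewrite uz; last by lia.
  rewrite zx; last by lia.
  by rewrite yxP//; lia.
rewrite (_ : overwrite L z y = v)//; apply/funext => k; rewrite /overwrite.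
case: ifPn => kL; first by rewrite vu ?uz//; lia.
have [kL'|kL'] := leP L%:Z k; first by rewrite vy//; lia.
by rewrite vu ?uy//; lia.
Qed.

Lemma overwriteK L x z y : cyl L x y -> overwrite L x (overwrite L z y) = y.
Proof.
move=> [_ /= yx]; apply/funext => k; rewrite /overwrite.
case: ifPn => kL; last by rewrite (negbTE kL).
by rewrite (_ : k = (absz k)%:Z); [rewrite yx//; lia|lia].
Qed.

Lemma measurable_overwrite L z : measurable_fun setT (overwrite L z).
Proof.
apply: measurable_fun_full_shift => x m; exists m => y xy n nm.
by rewrite /overwrite; case: ifP => // _; exact: xy.
Qed.

(** The inverse overwrites the window by [x]; hence images are preimages under another continuous
    map. *)
Lemma overwrite_holonomy L x z : (M <= L)%N -> X x -> X z ->
  (forall k : int, k < M%:Z \/ (L - M)%N%:Z <= k -> z k = x k) ->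
  is_holonomy X (cyl L x) (cyl L z) (overwrite L z).
Proof.
move=> ML Xx Xz zx.
have xz (k : int) : k < M%:Z \/ (L - M)%N%:Z <= k -> x k = z k by move=> /zx.
have h1 y : cyl L x y -> cyl L z (overwrite L z y) by exact: overwrite_cyl.
have h2 y : cyl L z y -> cyl L x (overwrite L x y) by exact: overwrite_cyl.
have m1 := measurable_cyl L x; have m2 := measurable_cyl L z.
split; [by split=> // y []|by split=> // y []| |].
- split.
  + split=> //; last first.
      by move=> y zy; exists (overwrite L x y); rewrite ?overwriteK//; exact: h2.
    move=> y y' /set_mem xy /set_mem xy' /(congr1 (overwrite L x)).
    by rewrite !overwriteK.
  + exact: measurable_funTS (measurable_overwrite L z).
  + move=> G mG GE; have -> : overwrite L z @` G =
        cyl L z `&` overwrite L x @^-1` G.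
      apply/seteqP; split=> [_ [y Gy <-]|y [zy Gy]].
        by split; [exact/h1/GE|rewrite /preimage/= overwriteK//; exact: GE].
      by exists (overwrite L x y) => //; rewrite overwriteK.
    apply: measurableI => //; rewrite -(setTI (_ @^-1` _)).
    exact: measurable_overwrite.
- move=> y xy; split; [exact: xy.1|exact: (h1 _ xy).1|].
  by exists L.+1 => // n nL; rewrite /overwrite ifN//; lia.
Qed.

End holonomies.

Section gibbs_inequality.
Variables (R : realType) (A : alphabetType) (X : set (full_shift A)).
Implicit Types x y z : full_shift A.

Lemma preimage_shift_map (i : int) (B : set (full_shift A)) :
  shift_map i @^-1` (shift_map 1 @^-1` B) = shift_map (i + 1) @^-1` B.
Proof.
apply/seteqP; split=> x; rewrite /preimage /=;
  by congr (B _); apply/funext => k; rewrite /shift_map; congr x; lia.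
Qed.

Lemma shift_map0 x : shift_map 0 x = x.
Proof. by apply/funext => k; rewrite /shift_map addr0. Qed.

Lemma shift_mapD (i j : int) x : shift_map i (shift_map j x) = shift_map (i + j) x.
Proof. by apply/funext => k; rewrite /shift_map addrA. Qed.

Lemma measurable_preimage_shift (i : int) (E : set (full_shift A)) :
  measurable E -> measurable (shift_map i @^-1` E).
Proof.
by move=> mE; rewrite -(setTI (_ @^-1` _)); exact: measurable_shift_map.
Qed.

Lemma shift_space_preimage (i : int) : is_shift_space X ->
  shift_map i @^-1` X = X.
Proof.
move=> sX; apply/seteqP; split=> x; last exact: sX.2.
by move=> /(sX.2 (- i)); rewrite shift_mapD addNr shift_map0.
Qed.

Lemma invariant_shift (mu : probability (full_shift A) R) :
  shift_invariant mu ->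
  forall (i : int) E, measurable E -> mu (shift_map i @^-1` E) = mu E.
Proof.
move=> inv.
have pos (n : nat) E : measurable E -> mu (shift_map n%:Z @^-1` E) = mu E.
  elim: n E => [|n IH] E mE.
    by congr (mu _); apply/seteqP; split=> x; rewrite /preimage /= shift_map0.
  rewrite -(inv _ mE) -(IH _ (measurable_preimage_shift 1 mE)) preimage_shift_map.
  by rewrite (_ : n%:Z + 1 = n.+1%:Z)//; lia.
move=> [n|n] E mE; first exact: pos.
rewrite -(pos n.+1 _ (measurable_preimage_shift _ mE)).
congr (mu _); apply/seteqP; split=> x; rewrite /preimage /= shift_mapD;
  by rewrite (_ : Negz n + n.+1%:Z = 0) ?shift_map0//; lia.
Qed.

Lemma measure_fin_cover (mu : probability (full_shift A) R) (I : finType)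
    (E : set (full_shift A)) (C : I -> set (full_shift A)) (r : R) :
  measurable E -> (forall i, measurable (C i)) ->
  (forall x, E x -> exists i, C i x) -> (forall i, (mu (C i) <= r%:E)%E) ->
  (mu E <= (#|I|%:R * r)%:E)%E.
Proof.
move=> mE mC EC Cr; pose D := \big[setU/set0]_(i : I) C i.
have [mD muD] : measurable D /\ (mu D <= (\sum_(i : I) r)%:E)%E.
  rewrite /D; elim/big_ind2: _ => [|D1 r1 D2 r2 [m1 h1] [m2 h2]|i _] //.
    by rewrite measure0.
  split; first exact: measurableU.
  by rewrite EFinD; apply: le_trans (measureU2 _ _ _) _ => //; exact: leeD.
apply: (@le_trans _ _ (mu D)).
  apply: le_measure; rewrite ?inE// => x /EC[i Ci].
  by rewrite /D (bigD1 i)//=; left.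
by apply: le_trans muD _; rewrite sumr_const mulr_natl.
Qed.

Variables (f : full_shift A -> R) (mu : probability (full_shift A) R).
Hypotheses (sft : is_sft X) (irr : is_irreducible X).
Hypotheses (fSV : summable_variation X f).
Hypotheses (inv : shift_invariant mu) (gibbs : is_gibbs X f mu).

Let sX : is_shift_space X := sft.1.
Let mX : measurable X := measurable_shift_space sX.

(** The word of [x] is placed in the middle of a window with [T] free letters on each side. Each
    resulting cylinder is carried by a splicing holonomy into a translate of the cylinder of [y],
    and their number is bounded independently of [n]. *)
Lemma cyl_compare : exists M C, forall n x y, (M <= n)%N -> X x -> X y ->
  fine (mu (cyl X n x)) <=
  expR (birkhoff f n x - birkhoff f n y + C) * fine (mu (cyl X n y)).
Proof.
have [M M0 glueX] := sft_glue sft.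
have [T TP] := splice sX irr M0 glueX.
have [V2 dist] := birkhoff_distortion sX fSV.
have [V1 coc] := cocycle_ge sX fSV.
have [B [B0 birkB]] := birkhoff_bounded sX fSV.
(* One cocycle error, four distortions (two over length [n], two over the long window), and the
   [T.*2] additional letters in each of the two long Birkhoff sums. *)
pose V := V1 + V2 *+ 4 + B * (T.*2)%:R *+ 2.
exists M, (ln (#|{ffun 'I_(T.*2) -> A}|%:R) + V) => n x y Mn Xx Xy.
pose L := (n + T.*2)%N; pose r := expR (birkhoff f n x - birkhoff f n y + V)
  * fine (mu (cyl X n y)).
have mcyl := measurable_cyl mX.
have fcyl k u : mu (cyl X k u) \is a fin_num by apply: fin_num_measure.
have lo u : X u -> shift_map T%:Z u \in cyl X n x -> (mu (cyl X L u) <= r%:E)%E.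
  move=> Xu /set_mem[_ /= ux].
  have [j [z [jT Xz zu zy]]] := TP n u y Mn Xu Xy.
  have ML : (M <= L)%N by rewrite /L; lia.
  have hol := overwrite_holonomy mX glueX ML Xu Xz zu.
  pose c := birkhoff f n y - birkhoff f n x - V.
  have SLu : birkhoff f L u <= birkhoff f n x + V2 + B * (T.*2)%:R.
    have -> : L = (T + (n + T))%N by rewrite /L; lia.
    rewrite birkhoffD birkhoffD.
    have := birkB T u Xu; rewrite ler_norml => /andP[_ h1].
    have h2 : birkhoff f n (shift_map T%:Z u) <= birkhoff f n x + V2.
      by apply: dist => //; exact: sX.2.
    have Xs : X (shift_map n%:Z (shift_map T%:Z u)) by do 2 apply: sX.2.
    have := birkB T _ Xs; rewrite ler_norml => /andP[_ h3].
    rewrite -addnn natrD mulrDr; lra.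
  have SLz : birkhoff f n y - V2 - B * (T.*2)%:R <= birkhoff f L z.
    have -> : L = (j + (n + (T.*2 - j)))%N by rewrite /L; lia.
    rewrite birkhoffD birkhoffD.
    have := birkB j z Xz; rewrite ler_norml => /andP[h1 _].
    have h2 : birkhoff f n y <= birkhoff f n (shift_map j%:Z z) + V2.
      apply: dist => //; first exact: sX.2.
      by move=> i iin; rewrite /shift_map addrC zy.
    have Xs : X (shift_map n%:Z (shift_map j%:Z z)) by do 2 apply: sX.2.
    have := birkB (T.*2 - j)%N _ Xs; rewrite ler_norml => /andP[h3 _].
    rewrite -{1}(subnKC jT) natrD mulrDr; lra.
  have h : ((expR c)%:E * mu (cyl X L u) <= mu (cyl X L z))%E.
    apply: (holonomy_measure_ge mX gibbs hol) => v uv.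
    have zv := overwrite_cyl glueX ML Xz zu uv.
    have ow (k : int) : k < 0 \/ L%:Z <= k -> v k = overwrite L z v k.
      by move=> kL; rewrite /overwrite ifN//; lia.
    have h0 := coc L _ _ uv.1 zv.1 ow.
    have h1 : birkhoff f L z <= birkhoff f L (overwrite L z v) + V2.
      by apply: dist => //; [exact: zv.1|move=> i iL; rewrite zv.2].
    have h2 : birkhoff f L v <= birkhoff f L u + V2.
      by apply: dist => //; [exact: uv.1|move=> i iL; rewrite uv.2].
    rewrite /c /V; lra.
  have h' : (mu (cyl X L z) <= mu (cyl X n y))%E.
    rewrite -(invariant_shift inv j%:Z (mcyl n y)).
    apply: le_measure; rewrite ?inE//; first exact: measurable_preimage_shift.
    move=> v [Xv /= vz]; split; first exact: sX.2.
    move=> i iin /=; rewrite /shift_map -zy// addrC.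
    by rewrite -(vz (j + i)%N)//; rewrite /L; lia.
  have := le_trans h h'.
  rewrite -(fineK (fcyl L u)) -(fineK (fcyl n y)) -EFinM !lee_fin => h''.
  rewrite /r (_ : _ + V = - c); last by rewrite /c; lra.
  by rewrite expRN ler_pdivlMl ?expR_gt0.
have := @measure_fin_cover mu {ffun 'I_(T.*2) -> A} (shift_map T%:Z @^-1` cyl X n x).
(* The [T] letters before and the [T] letters after the word of [x]; together with that word they
   determine the long cylinder. *)
pose outer (u : full_shift A) : {ffun 'I_(T.*2) -> A} :=
  [ffun i : 'I_(T.*2) => if (i < T)%N then u (i : nat)%:Z else u ((i : nat) + n)%N%:Z].
have /choice[C CP] W : exists C : set (full_shift A), [/\ measurable C,
    (mu C <= r%:E)%E & forall u, X u -> shift_map T%:Z u \in cyl X n x ->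
      outer u = W -> C u].
  have [[u [Xu uT uW]]|nu] := pselect (exists u, [/\ X u,
      shift_map T%:Z u \in cyl X n x & outer u = W]); last first.
    exists set0; split=> //; last by move=> u Xu uT uW; case: nu; exists u.
    by rewrite measure0 lee_fin mulr_ge0 ?expR_ge0// fine_ge0.
  exists (cyl X L u); split=> //; first exact: lo.
  move=> v Xv /set_mem[_ /= vx] vW; split=> // k kL.
  move/set_mem: uT => [_ /= ux].
  have [kT|Tk] := ltnP k T.
    have k2 : (k < T.*2)%N by lia.
    have := congr1 (fun g : {ffun 'I_(T.*2) -> A} => g (Ordinal k2)) vW.
    by rewrite -uW !ffunE /= kT.
  have [kn|nk] := ltnP k (T + n).
    have e w : w k%:Z = shift_map T%:Z w (k - T)%N%:Z.
      by rewrite /shift_map; congr w; lia.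
    by rewrite !e vx ?ux//; lia.
  have k2 : (k - n < T.*2)%N by rewrite /L in kL; lia.
  have := congr1 (fun g : {ffun 'I_(T.*2) -> A} => g (Ordinal k2)) vW.
  have nT : (k - n < T)%N = false by lia.
  by rewrite -uW !ffunE /= nT subnK//; lia.
move=> /(_ C r (measurable_preimage_shift _ (mcyl n x))).
rewrite (invariant_shift inv)// => /(_ (fun W => let: And3 a _ _ := CP W in a)).
move=> /(_ _ (fun W => let: And3 _ a _ := CP W in a)) h.
have {h} : (mu (cyl X n x) <= (#|{ffun 'I_(T.*2) -> A}|%:R * r)%:E)%E.
  apply: h => u uT; have Xu : X u by rewrite -(shift_space_preimage T%:Z sX); exact: uT.1.
  exists (outer u); have [_ _ h] := CP (outer u); apply: h => //.
  exact: mem_set.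
rewrite -(fineK (fcyl n x)) lee_fin => /le_trans; apply.
rewrite /r mulrA ler_wpM2r ?fine_ge0// (addrCA _ (ln _)) [leRHS]expRD lnK//.
by rewrite posrE ltr0n; apply/card_gt0P; exists [ffun=> point].
Qed.

End gibbs_inequality.

(** * The partition function *)

Section partition_function.
Variables (R : realType) (A : alphabetType) (X : set (full_shift A)).
Variables (f : full_shift A -> R).
Hypotheses (sX : is_shift_space X) (fSV : summable_variation X f).
Hypothesis X0 : X !=set0.
Implicit Types x y z : full_shift A.

Let mX : measurable X := measurable_shift_space sX.

Definition lang n (w : {ffun 'I_n -> A}) := `[< exists x, X x /\ state n x 0 = w >].

Definition rep n (w : {ffun 'I_n -> A}) : full_shift A :=
  xget point [set x | X x /\ state n x 0 = w].

Lemma repP n w : @lang n w -> X (rep w) /\ state n (rep w) 0 = w.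
Proof. by move=> /asboolP h; exact: (xgetPex point h). Qed.

Lemma lang_state n x : X x -> lang (state n x 0).
Proof. by move=> Xx; apply/asboolP; exists x. Qed.

Lemma state0_eqP n x y : state n x 0 = state n y 0 <->
  (forall i : nat, (i < n)%N -> x i%:Z = y i%:Z).
Proof.
by rewrite state_eqP; split=> h i iin; have := h i iin; rewrite !add0r.
Qed.

Lemma birkhoff_rep : exists V, 0 <= V /\ forall n x, X x ->
  birkhoff f n x <= birkhoff f n (rep (state n x 0)) + V /\
  birkhoff f n (rep (state n x 0)) <= birkhoff f n x + V.
Proof.
have [V dist] := birkhoff_distortion sX fSV; exists `|V|; split=> // n x Xx.
have [Xr /state0_eqP rx] := repP (lang_state n Xx).
have VV := ler_norm V.
have h1 := dist n _ _ Xr Xx rx.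
by have := dist n _ _ Xx Xr (fun i iin => esym (rx i iin)); split; lra.
Qed.

Definition partition_function n : R :=
  \sum_(w : {ffun 'I_n -> A} | lang w) expR (birkhoff f n (rep w)).

Local Notation Z := partition_function.

Lemma partition_function_ge n x : X x ->
  expR (birkhoff f n (rep (state n x 0))) <= Z n.
Proof.
move=> Xx; rewrite /Z (bigD1 (state n x 0))/=; last exact: lang_state.
by rewrite lerDl sumr_ge0// => w _; exact: expR_ge0.
Qed.

Lemma partition_function_gt0 n : 0 < Z n.
Proof.
by have [x Xx] := X0; apply: lt_le_trans (partition_function_ge n Xx); exact: expR_gt0.
Qed.

(** Cutting a word of length m + n gives an injection into pairs of words of [X]; each piece costs
    one distortion for the change of its evaluation point. *)
Lemma partition_function_submul : exists V, 0 <= V /\ forall m n,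
  ln (Z (m + n)) <= V + (ln (Z m) + ln (Z n)).
Proof.
have [V [V0 repV]] := birkhoff_rep; exists (V *+ 2); split=> [|m n].
  by rewrite mulrn_wge0.
rewrite -[V *+ 2]expRK -lnM ?posrE ?partition_function_gt0//.
rewrite -lnM ?posrE ?expR_gt0// ?mulr_gt0 ?partition_function_gt0//.
rewrite ler_ln ?posrE ?mulr_gt0 ?expR_gt0 ?partition_function_gt0//.
pose h (w : {ffun 'I_(m + n) -> A}) : {ffun 'I_m -> A} * {ffun 'I_n -> A} :=
  (state m (rep w) 0, state n (shift_map m%:Z (rep w)) 0).
pose G (t : {ffun 'I_m -> A} * {ffun 'I_n -> A}) :=
  expR (birkhoff f m (rep t.1)) * expR (birkhoff f n (rep t.2)).
pose Q (t : {ffun 'I_m -> A} * {ffun 'I_n -> A}) := lang t.1 && lang t.2.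
have hinj : {in @lang (m + n) &, injective h}.
  move=> w w' /repP[Xw wE] /repP[Xw' wE'] [/state0_eqP h1 /state0_eqP h2].
  set y := rep w in h1 h2 *; set y' := rep w' in h1 h2 *.
  have e : forall i : nat, (i < m + n)%N -> y i%:Z = y' i%:Z.
    move=> i imn; have [im|mi] := ltnP i m; first exact: h1.
    have := h2 (i - m)%N; rewrite /shift_map (_ : (i - m)%N%:Z + m%:Z = i%:Z); last by lia.
    by apply; lia.
  by rewrite -wE -wE'; apply/state0_eqP.
have -> : Z m * Z n = \sum_(t | Q t) G t.
  rewrite /Z big_distrl /=; under eq_bigr do rewrite big_distrr /=.
  by rewrite pair_big_dep.
apply: (@le_trans _ _ (\sum_(w | @lang (m + n) w) expR (V *+ 2) * G (h w))).
  apply: ler_sum => w /repP[Xw wE]; rewrite /G -!expRD ler_expR birkhoffD.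
  have [h1 _] := repV m _ Xw; have [h2 _] := repV n _ (sX.2 m%:Z _ Xw).
  by rewrite /h /=; lra.
rewrite -big_distrr /= ler_wpM2l ?expR_ge0//.
rewrite -(big_imset G hinj) /= big_mkcond [leRHS]big_mkcond /=.
apply: ler_sum => t _; have G0 : 0 <= G t by rewrite mulr_ge0 ?expR_ge0.
case: ifPn => [/imsetP[w /repP[Xw _] ->]|_]; last by case: ifP.
by rewrite /Q /h /= !lang_state//; exact: sX.2.
Qed.

(** Adding the constant [V] makes [ln (Z n)] exactly subadditive; for large [n] it is absorbed in
    half of the error. *)
Lemma pressure_limit : exists p, forall e, 0 < e -> exists N, forall n, (N <= n)%N ->
  `|ln (Z n) - p * n%:R| <= e * n%:R.
Proof.
have [V [V0 sub]] := partition_function_submul.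
have [B [B0 birkB]] := birkhoff_bounded sX fSV.
have [||p pP] := @fekete R (fun n => ln (Z n) + V) B.
- by move=> m n; have := sub m n; lra.
- move=> n; have [x Xx] := X0; have [Xr _] := repP (lang_state n Xx).
  have := partition_function_ge n Xx.
  rewrite -ler_ln ?posrE ?expR_gt0 ?partition_function_gt0// expRK.
  have := birkB n _ Xr; rewrite ler_norml => /andP[h1 _]; lra.
exists p => e e0; have e2 : 0 < e / 2 by rewrite divr_gt0.
have [N NP] := pP _ e2; exists (maxn N (Num.truncn (V / (e / 2))).+1) => n nN.
have Vn : V <= e / 2 * n%:R.
  rewrite mulrC -ler_pdivrMr// ltW//; apply: lt_le_trans (truncnS_gt _) _.
  by rewrite ler_nat; apply: leq_trans nN; exact: leq_maxr.
have := NP n (leq_trans (leq_maxl _ _) nN); rewrite !ler_norml => /andP[h1 h2].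
by apply/andP; split; lra.
Qed.

Section invariant_measure.
Variable nu : probability (full_shift A) R.
Hypotheses (nuX : nu X = 1%E) (inv : shift_invariant nu).

Local Notation I := (\int[nu]_(x in X) f x).

Lemma potential_bounded_measurable (i : int) :
  bounded_measurable X (fun x => f (shift_map i x)).
Proof.
apply: (@bounded_measurable_comp _ _ _ X mX (shift_map i) _ _ f).
- exact: measurable_shift_map.
- exact: shift_space_preimage.
- by split; [exact: potential_measurable|exact: potential_bounded].
Qed.

Lemma birkhoff_bounded_measurable n (j : int) :
  bounded_measurable X (fun x => birkhoff f n (shift_map j x)).
Proof.
apply: bounded_measurable_sum => i.
under eq_fun do rewrite shift_mapD; exact: potential_bounded_measurable.
Qed.

Lemma Rintegral_birkhoff n (j : int) :
  \int[nu]_(x in X) birkhoff f n (shift_map j x) = n%:R * I.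
Proof.
rewrite /birkhoff bounded_Rintegral_sum//; last first.
  move=> i; under eq_fun do rewrite shift_mapD; exact: potential_bounded_measurable.
rewrite (eq_bigr (fun=> I)) => [|i _]; last first.
  under eq_Rintegral do rewrite shift_mapD.
  apply: (@Rintegral_invariant _ _ _ nu X mX (shift_map (i%:Z + j))).
  - exact: measurable_shift_map.
  - exact: shift_space_preimage.
  - by move=> E; exact: invariant_shift.
  - by split; [exact: potential_measurable|exact: potential_bounded].
by rewrite big_const_nat iter_addr_0 subn0 mulr_natl.
Qed.

End invariant_measure.

End partition_function.

(** * Entropy bounds *)

Section entropy_bounds.
Variables (R : realType) (A : alphabetType) (X : set (full_shift A)).
Variables (f : full_shift A -> R).
Hypotheses (sX : is_shift_space X) (fSV : summable_variation X f).
Implicit Types x y z : full_shift A.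

Let mX : measurable X := measurable_shift_space sX.
Local Notation Z := (partition_function X f).

Lemma measurable_state_fiber m (j : int) (w : {ffun 'I_m -> A}) :
  measurable (X `&` [set x | state m x j = w]).
Proof.
apply: measurableI => //; apply: (@measurable_local _ (m + absz j)%N) => x y xy /= <-.
by apply/state_eqP => i im; apply: xy; lia.
Qed.

Section lower_bound.
Variable mu : probability (full_shift A) R.
Hypotheses (sft : is_sft X) (irr : is_irreducible X).
Hypotheses (inv : shift_invariant mu) (gibbs : is_gibbs X f mu).

(** A fibre of [g] lies in one [n]-cylinder, so the Gibbs bound gives - ln of its mass at least ln
    Z_n - S_n f up to a constant; integration concludes. A general [g] lets this apply to
    itineraries. *)
Lemma entropy_lower_bound : exists M C, forall n, (M <= n)%N ->
  forall (J : finType) (g : full_shift A -> J),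
  (forall j, measurable (X `&` [set x | g x = j])) ->
  (forall x y, X x -> X y -> g x = g y ->
    forall i : nat, (i < n)%N -> x i%:Z = y i%:Z) ->
  ln (Z n) - n%:R * \int[mu]_(x in X) f x - C <=
    \sum_j entropy_fun (fiber_prob mu X g j).
Proof.
have muX : mu X = 1%E by case: gibbs.
have [M [C cmp]] := cyl_compare sft irr fSV inv gibbs.
have [V dist] := birkhoff_distortion sX fSV.
have X0 := probability_nonempty muX.
exists M, (C + V) => n Mn J g mg ginj.
have Zgt0 : 0 < Z n by exact: partition_function_gt0.
(* The comparison with each word of length [n] is summed; the cylinders of these words have total
   mass at most 1. *)
have gibbs_ub x : X x ->
    Z n * fine (mu (cyl X n x)) <= expR (birkhoff f n x + C).
  move=> Xx; rewrite /partition_function big_distrl /=.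
  apply: (@le_trans _ _ (\sum_(w : {ffun 'I_n -> A}) expR (birkhoff f n x + C) *
      fiber_prob mu X (fun y => state n y 0) w)); last first.
    rewrite -big_distrr /= fiber_prob_sum1 ?mulr1// => w.
    exact: measurable_state_fiber.
  rewrite big_mkcond /=; apply: ler_sum => w _; case: ifPn => [lw|_]; last first.
    by rewrite mulr_ge0 ?expR_ge0// fiber_prob_ge0.
  have [Xr rw] := repP lw.
  have -> : fiber_prob mu X (fun y => state n y 0) w = fine (mu (cyl X n (rep X w))).
    congr (fine (mu (X `&` _))); apply/seteqP; split=> y /=.
      by move=> yw; apply/state0_eqP; rewrite yw rw.
    by move=> /state0_eqP ->.
  have := ler_wpM2l (expR_ge0 (birkhoff f n (rep X w))) (cmp n _ _ Mn Xx Xr).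
  by move/le_trans; apply; rewrite mulrA -expRD ler_wpM2r ?fine_ge0// ler_expR; lra.
pose r j := xget point (X `&` [set x | g x = j]).
have rP x : X x -> X (r (g x)) /\ g (r (g x)) = g x.
  move=> Xx; have h : exists y, (X `&` [set y | g y = g x]) y by exists x.
  exact: (xgetPex point h).
pose F j := ln (Z n) - C - birkhoff f n (r j).
apply: (@le_trans _ _ (\int[mu]_(x in X) F (g x))); last first.
  rewrite (Rintegral_fiber mX muX mg F); apply: ler_sum => j _.
  have := fiber_prob_ge0 mu X g j; rewrite /entropy_fun le_eqVlt.
  move=> /predU1P[<-|p0]; first by rewrite mulr0 mul0r oppr0.
  have [x Xx gx] : exists2 x, X x & g x = j.
    apply: contrapT => nx; move: p0; rewrite /fiber_prob (_ : X `&` _ = set0).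
      by rewrite measure0 ltxx.
    by rewrite -subset0 => x [Xx gx]; case: nx; exists x.
  have [Xr gr] := rP x Xx; rewrite gx in Xr gr.
  rewrite mulrC -mulrN ler_wpM2l ?(ltW p0)// /F.
  have pc : fiber_prob mu X g j <= fine (mu (cyl X n (r j))).
    rewrite fine_le// ?fin_num_measure//; try exact: measurable_cyl.
    apply: le_measure; rewrite ?inE//; first exact: measurable_cyl.
    move=> y [Xy /= gy]; split=> // i iin.
    by apply: (ginj y (r j)) => //; rewrite gy gr.
  have := gibbs_ub _ Xr; have c0 := lt_le_trans p0 pc.
  rewrite -ler_ln ?posrE ?mulr_gt0 ?expR_gt0// expRK lnM ?posrE// => h1.
  have : ln (fiber_prob mu X g j) <= ln (fine (mu (cyl X n (r j)))).
    by rewrite ler_ln ?posrE.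
  lra.
have bF : bounded_measurable X (fun x => F (g x)) by exact: bounded_measurable_fiber.
have bB : bounded_measurable X (fun x => -1 * birkhoff f n (shift_map 0 x)).
  by apply: bounded_measurableZ; exact: birkhoff_bounded_measurable.
have bB' := bounded_measurableD (bounded_measurable_cst X (ln (Z n) - C - V)) bB.
apply: le_trans (le_bounded_Rintegral mu mX bB' bF _); last first.
  move=> x Xx; have [Xr gr] := rP x Xx; rewrite /F shift_map0.
  have := dist n _ _ Xr Xx (ginj _ _ Xr Xx gr); lra.
rewrite bounded_RintegralD//; last exact: bounded_measurable_cst.
rewrite bounded_Rintegral_cst// bounded_RintegralZ//; last first.
  exact: birkhoff_bounded_measurable.
rewrite Rintegral_birkhoff//; lra.
Qed.

End lower_bound.

Section upper_bound.
Variable nu : probability (full_shift A) R.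
Hypotheses (nuX : nu X = 1%E) (inv : shift_invariant nu).
Variables (k : nat) (P : 'I_k -> set (full_shift A)).
Hypothesis finP : is_finite_partition X P.
Variable idx : full_shift A -> 'I_k.
Hypothesis idxP : forall x, X x -> P (idx x) x.

Definition itinerary n x : {ffun 'I_n -> 'I_k} :=
  [ffun i : 'I_n => idx (shift_map (i : nat)%:Z x)].

Lemma partition_index x i : X x -> P i x -> idx x = i.
Proof.
have [[_ tP _] _] := finP; move=> Xx Px.
by apply: tP => //; exists x; split=> //; exact: idxP.
Qed.

Lemma iter_shift_map n x : iter n (shift_map 1) x = shift_map n%:Z x.
Proof.
elim: n => [|n IH]; first by rewrite shift_map0.
by rewrite iterS IH shift_mapD; congr shift_map; lia.
Qed.

(** Atoms of the join become fibres of the itinerary map, to which the bounds for finite-valued maps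
    apply. *)
Lemma join_atomE n c : join_atom X (shift_map 1) P c =
  X `&` [set x | itinerary n x = c].
Proof.
apply/seteqP; split=> x [Xx /= h]; split=> //.
  apply/ffunP => i; rewrite ffunE; apply: partition_index; first exact: sX.2.
  by have := h i I; rewrite /preimage /= iter_shift_map.
by move=> i _; rewrite /preimage /= iter_shift_map -h ffunE; apply: idxP; exact: sX.2.
Qed.

Lemma join_entropyE n : join_entropy nu X (shift_map 1) P n =
  \sum_c entropy_fun (fiber_prob nu X (itinerary n) c).
Proof. by apply: eq_bigr => c _; rewrite join_atomE. Qed.

Lemma measurable_itinerary n c : measurable (X `&` [set x | itinerary n x = c]).
Proof.
rewrite -join_atomE; apply: measurableI => //; apply: fin_bigcap_measurable => // i _.
have -> : iter i (shift_map 1) = shift_map (i : nat)%:Z :> (full_shift A -> _).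
  by apply/funext => x; rewrite iter_shift_map.
by apply: measurable_preimage_shift; exact: finP.2.
Qed.

End upper_bound.
End entropy_bounds.

Section entropy_upper_bound.
Variables (R : realType) (A : alphabetType) (X : set (full_shift A)).
Variables (f : full_shift A -> R).
Hypotheses (sX : is_shift_space X) (fSV : summable_variation X f).
Variable nu : probability (full_shift A) R.
Hypotheses (nuX : nu X = 1%E) (inv : shift_invariant nu).
Implicit Types x y z : full_shift A.

Let mX : measurable X := measurable_shift_space sX.
Local Notation Z := (partition_function X f).
Local Notation I := (\int[nu]_(x in X) f x).

(** This builds the kernel kappa: a correct guess has weight exp (-e), and the remaining mass 1 -
    exp (-e) is divided by [k] to weight each wrong one. *)
Lemma sum_expRN_cost k (i0 : 'I_k) (e : R) : 0 < e -> exists2 L : R, 0 <= L &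
  forall j', \sum_(j < k) expR (- (if j == j' then e else L)) <= 1.
Proof.
move=> e0; have k0 : (0 < k)%N by exact: leq_ltn_trans (ltn_ord i0).
pose d := 1 - expR (- e).
have d0 : 0 < d by rewrite subr_gt0 expR_lt1 oppr_lt0.
have dk0 : 0 < d / k%:R by rewrite divr_gt0// ltr0n.
have dk1 : d / k%:R <= 1.
  rewrite ler_pdivrMr ?ltr0n// mul1r (@le_trans _ _ 1)//; last by rewrite ler1n.
  by rewrite /d gerBl expR_ge0.
exists (- ln (d / k%:R)) => [|j']; first by rewrite oppr_ge0 ln_le0.
rewrite (bigD1 j')//= eqxx.
rewrite (eq_bigr (fun=> d / k%:R)) => [|j jj']; last first.
  by rewrite (negbTE jj') opprK lnK.
apply: (@le_trans _ _ (expR (- e) + \sum_(j < k) d / k%:R)).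
  rewrite lerD2l [leRHS](bigD1 j')//= lerDr; exact: ltW.
rewrite sumr_const card_ord -(mulr_natr (d / _)) divfK ?pnatr_eq0 -?lt0n//.
by rewrite /d addrC subrK.
Qed.

Lemma entropy_upper_bound (p : R) (k : nat) (P : 'I_k -> set (full_shift A)) (e : R) :
  (forall e, 0 < e -> exists N, forall n, (N <= n)%N ->
    `|ln (Z n) - p * n%:R| <= e * n%:R) ->
  is_finite_partition X P -> 0 < e ->
  exists N, forall n, (N <= n)%N ->
    join_entropy nu X (shift_map 1) P n <= (p - I + e) * n%:R.
Proof.
move=> pP finP e0; have [[coverP tP _] mP] := finP.
have X0 := probability_nonempty nuX.
have Zgt0 n : 0 < Z n by exact: partition_function_gt0.
have Pex x : X x -> exists i, P i x by rewrite -coverP => -[i _ Px]; exists i.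
have [i0 _] : exists i0 : 'I_k, True.
  by have [x /Pex[i _]] := X0; exists i.
pose idx x := odflt i0 [pick i | `[< P i x >]].
have idxP x : X x -> P (idx x) x.
  move=> /Pex[i Pix]; rewrite /idx; case: pickP => [j /asboolP//|/(_ i)].
  by move/asboolP.
have e4 : 0 < e / 4 by rewrite divr_gt0.
have [L L0 costL] := sum_expRN_cost i0 e4.
(* A wrong guess costs [L] and occurs only in a set of mass at most [d], hence at most e / 4 per
   time step on average. The other quarters pay for ln Z_m, for the correct guesses and for [K]. *)
pose d := e / 4 / (L + 1).
have L10 : 0 < L + 1 by rewrite ltr_wpDl.
have d0 : 0 < d by rewrite divr_gt0.
have Ld : L * d <= e / 4.
  by rewrite /d mulrA ler_pdivrMr// mulrC ler_wpM2l ?(ltW e4)// lerDl.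
have [N [Q [D [QN mD nuD PQ]]]] := local_index nu i0 tP mP d0.
have [V [V0 repV]] := birkhoff_rep sX fSV.
have [N1 N1P] := pP _ e4.
pose K := V + `|p + e / 4 - I| * (N.*2)%:R.
exists (maxn N1 (Num.truncn (K / (e / 4))).+1) => n nN.
have Kn : K <= e / 4 * n%:R.
  rewrite mulrC -ler_pdivrMr// ltW//; apply: lt_le_trans (truncnS_gt _) _.
  by rewrite ler_nat; apply: leq_trans nN; exact: leq_maxr.
have N1n : (N1 <= n)%N by apply: leq_trans nN; exact: leq_maxl.
pose m := (n + N.*2)%N.
have lnZm : ln (Z m) <= (p + e / 4) * m%:R.
  have := N1P m (leq_trans N1n (leq_addr _ _)); rewrite ler_norml => /andP[_]; lra.
(* The word of x on [-N, n + N) determines Q at all times i < n. *)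
pose h x := state m x (- N%:Z).
(* Only the coordinates in [0, m) are read below, so the reflection caused by [absz] and the default
   letter are harmless. *)
pose pt (w : {ffun 'I_m -> A}) : full_shift A := fun l : int =>
  if insub (absz l) is Some i then w i else point.
pose Qw (i : nat) w := Q (shift_map (i + N)%N%:Z (pt w)).
have QwE x (i : 'I_n) : Qw i (h x) = Q (shift_map (i : nat)%:Z x).
  apply: QN => l lN; rewrite /shift_map /pt.
  have lm : (absz (l + (i + N)%N%:Z)%R < m)%N by have := ltn_ord i; rewrite /m; lia.
  by rewrite insubT ffunE /=; congr x; lia.
pose cost (j j' : 'I_k) := if j == j' then e / 4 else L.
pose q (t : {ffun 'I_n -> 'I_k} * {ffun 'I_m -> A}) :=
  (if lang X t.2 then expR (birkhoff f m (rep X t.2)) / Z m else 0) *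
  \prod_(i < n) expR (- cost (t.1 i) (Qw i t.2)).
have q0 t : 0 <= q t.
  rewrite /q mulr_ge0//; last by apply: prodr_ge0 => i _; exact: expR_ge0.
  by case: ifP => // _; rewrite divr_ge0 ?expR_ge0// ltW.
have hlang x : X x -> lang X (h x).
  move=> Xx; apply/asboolP; exists (shift_map (- N%:Z) x).
  by rewrite state_shift add0r; split=> //; exact: sX.2.
have qE x : X x -> q (itinerary idx n x, h x) =
    expR (birkhoff f m (rep X (h x)) - ln (Z m)
    - \sum_(i < n) cost (idx (shift_map (i : nat)%:Z x)) (Q (shift_map (i : nat)%:Z x))).
  move=> Xx; rewrite /q /= hlang// !expRD expRN lnK ?posrE//; congr (_ * _).
  rewrite -sumrN expR_sum; apply: eq_bigr => i _.
  by rewrite ffunE QwE.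
have qX x : X x -> 0 < q (itinerary idx n x, h x) by move=> /qE ->; exact: expR_gt0.
(* For a fixed word the sum over itineraries factors into one sum of kernel weights per time; the
   word weights then add up to 1. *)
have q1 : \sum_t q t <= 1.
  rewrite -(pair_big_dep xpredT (fun _ => xpredT) (fun c w => q (c, w))) /=.
  rewrite exchange_big /=.
  apply: (@le_trans _ _ (\sum_(w : {ffun 'I_m -> A})
    (if lang X w then expR (birkhoff f m (rep X w)) / Z m else 0))).
    apply: ler_sum => w _; rewrite /q /= -big_distrr /=.
    rewrite ler_piMr//.
      by case: ifP => // _; rewrite divr_ge0 ?expR_ge0// ltW.
    rewrite -(bigA_distr_bigA (fun (i : 'I_n) j => expR (- cost j (Qw i w)))).
    apply: prodr_ile1 => i _; rewrite costL andbT.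
    by apply: sumr_ge0 => j _; exact: expR_ge0.
  rewrite -big_mkcond /= -big_distrl /= -/(Z m) divff//.
  by rewrite gt_eqF.
have mit := measurable_itinerary sX finP idxP.
have mh w : measurable (X `&` [set x | h x = w]) by exact: measurable_state_fiber.
rewrite (join_entropyE sX nu finP idxP).
apply: le_trans (entropy_le_cross mX nuX (mit n) mh q0 qX q1) _.
(* [G] majorises - ln q: every time is charged e / 4, and [L] more is charged when the orbit is in
   [D], the only place where [Q] can miss the index. *)
pose G x := (ln (Z m) + V + n%:R * (e / 4)) + (-1 * birkhoff f m (shift_map (- N%:Z) x) +
  \sum_(i <- enum 'I_n) L * \1_(shift_map (i : nat)%:Z @^-1` D) x).
have mSD (i : 'I_n) : measurable (shift_map (i : nat)%:Z @^-1` D).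
  exact: measurable_preimage_shift.
have b1 : bounded_measurable X (fun x => -1 * birkhoff f m (shift_map (- N%:Z) x)).
  by apply: bounded_measurableZ; exact: birkhoff_bounded_measurable.
have b2 (i : 'I_n) : bounded_measurable X
    (fun x => L * \1_(shift_map (i : nat)%:Z @^-1` D) x : R).
  by apply: bounded_measurableZ; exact: bounded_measurable_indic.
have b3 := bounded_measurable_sum (enum 'I_n) b2.
have b12 := bounded_measurableD b1 b3.
have b4 := bounded_measurable_cst X (ln (Z m) + V + n%:R * (e / 4)).
have bG : bounded_measurable X G by exact: bounded_measurableD.
have bq : bounded_measurable X (fun x => - ln (q (itinerary idx n x, h x))).
  exact: (bounded_measurable_fiber (measurable_pair_fiber (mit n) mh) (fun t => - ln (q t))).
apply: le_trans (le_bounded_Rintegral nu mX bq bG _) _.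
  move=> x Xx; rewrite qE// expRK /G.
  have [h1 _] := repV m _ (sX.2 (- N%:Z) _ Xx).
  rewrite state_shift add0r -/(h x) in h1.
  have h2 : \sum_(i < n) cost (idx (shift_map (i : nat)%:Z x)) (Q (shift_map (i : nat)%:Z x))
      <= n%:R * (e / 4) + \sum_(i <- enum 'I_n) L * \1_(shift_map (i : nat)%:Z @^-1` D) x.
    have -> : n%:R * (e / 4) = \sum_(i < n) e / 4 by rewrite sumr_const card_ord mulr_natl.
    rewrite big_enum /= -big_split /=; apply: ler_sum => i _; rewrite /cost.
    case: eqP => [_|neq]; first by rewrite lerDl mulr_ge0// indicE ler0n.
    rewrite indicE mem_set ?mulr1 ?lerDr ?(ltW e4)// /preimage /=.
    apply: contrapT => nD; apply: neq; apply/esym; apply: PQ nD.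
    by apply: idxP; exact: sX.2.
  lra.
rewrite bounded_RintegralD// bounded_Rintegral_cst// bounded_RintegralD//.
rewrite bounded_RintegralZ//; last exact: birkhoff_bounded_measurable.
rewrite Rintegral_birkhoff// bounded_Rintegral_sum//.
have h3 : \sum_(i <- enum 'I_n) \int[nu]_(x in X) (L * \1_(shift_map (i : nat)%:Z @^-1` D) x)
    <= n%:R * (e / 4).
  have -> : n%:R * (e / 4) = \sum_(i <- enum 'I_n) e / 4.
    by rewrite big_enum sumr_const card_ord mulr_natl.
  apply: ler_sum => i _; rewrite bounded_RintegralZ//; last exact: bounded_measurable_indic.
  rewrite Rintegral_indicator//; apply: le_trans Ld; rewrite ler_wpM2l//.
  rewrite -lee_fin fineK ?fin_num_measure//; last exact: measurableI.
  apply: le_trans nuD; rewrite -(invariant_shift inv (i : nat)%:Z mD).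
  apply: le_measure; rewrite ?inE; [|exact: mSD|exact: subIsetl].
  exact: measurableI.
have h4 : (p + e / 4 - I) * (N.*2)%:R <= `|p + e / 4 - I| * (N.*2)%:R.
  by rewrite ler_wpM2r// ler_norm.
have mE : m%:R = n%:R + (N.*2)%:R :> R by rewrite /m natrD.
move: lnZm h3; rewrite mE => lnZm h3; rewrite /K in Kn.
set s := \sum_(i <- _) _ in h3 *.
apply: (@le_trans _ _ ((p + e / 4) * (n%:R + (N.*2)%:R) + V + n%:R * (e / 4)
  + (-1 * ((n%:R + (N.*2)%:R) * I) + n%:R * (e / 4)))); first by lra.
nra.
Qed.

End entropy_upper_bound.

(** * Free energies and the pressure *)

Section equilibrium.
Variables (R : realType) (A : alphabetType) (X : set (full_shift A)).
Variables (f : full_shift A -> R).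
Hypotheses (sX : is_shift_space X) (fSV : summable_variation X f).
Implicit Types nu : probability (full_shift A) R.

Let mX : measurable X := measurable_shift_space sX.
Local Notation Z := (partition_function X f).

Lemma join_entropy_ge0 nu k (P : 'I_k -> set (full_shift A)) n :
  (forall i, measurable (P i)) -> 0 <= join_entropy nu X (shift_map 1) P n.
Proof.
move=> mP; apply: sumr_ge0 => c _; rewrite /entropy_fun oppr_ge0.
rewrite mulr_ge0_le0 ?fine_ge0//.
have mc : measurable (join_atom X (shift_map 1) P c).
  apply: measurableI => //; apply: fin_bigcap_measurable => // i _.
  have -> : iter i (shift_map 1) = shift_map (i : nat)%:Z :> (full_shift A -> _).
    by apply/funext => x; rewrite iter_shift_map.
  exact: measurable_preimage_shift.
by rewrite ln_le0// -lee_fin fineK ?fin_num_measure// probability_le1.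
Qed.

Variable p : R.
Hypothesis pP : forall e, 0 < e -> exists N, forall n, (N <= n)%N ->
  `|ln (Z n) - p * n%:R| <= e * n%:R.

Lemma integral_potential nu : nu X = 1%E ->
  (\int[nu]_(x in X) (f x)%:E)%E = (\int[nu]_(x in X) f x)%:E.
Proof.
move=> nuX; rewrite /Rintegral fineK//; apply: integrable_fin_num => //.
apply: bounded_measurable_integrable => //.
by split; [exact: potential_measurable|exact: potential_bounded].
Qed.

Lemma partition_entropy_le nu k (P : 'I_k -> set (full_shift A)) :
  nu X = 1%E -> shift_invariant nu -> is_finite_partition X P ->
  partition_entropy nu X (shift_map 1) P <= p - \int[nu]_(x in X) f x.
Proof.
move=> nuX inv finP; apply/ler_addgt0Pr => e e0.
have [N NP] := entropy_upper_bound sX fSV nuX inv pP finP e0.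
pose u n : R := join_entropy nu X (shift_map 1) P n / n%:R.
have ule n : (N.+1 <= n)%N -> u n <= p - \int[nu]_(x in X) f x + e.
  move=> Nn; rewrite /u ler_pdivrMr ?ltr0n ?(leq_ltn_trans _ Nn)//.
  by apply: NP; exact: ltnW.
have [cu|dvg] := pselect (cvgn u).
  by apply: (limr_le cu); exists N.+1.
(* The limit of a divergent sequence is the default value [0]. *)
rewrite /partition_entropy (dvgP dvg).
apply: le_trans (ule N.+1 (leqnn _)); rewrite divr_ge0//.
by apply: join_entropy_ge0; exact: finP.2.
Qed.

Lemma free_energy_le nu : measure_on X nu -> shift_invariant nu ->
  (free_energy X f nu <= p%:E)%E.
Proof.
move=> nuX inv; rewrite /free_energy integral_potential//.
rewrite -leeBrDr// -EFinB; apply: ge_ereal_sup => _ [k [P [finP ->]]].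
by rewrite lee_fin; exact: partition_entropy_le.
Qed.

(** Only letters occurring in [X] index the pieces, since a [partition] has nonempty members. The
    last clause makes itineraries determine words. *)
Lemma letter_partition : X !=set0 ->
  exists k (P : 'I_k -> set (full_shift A)) (idx : full_shift A -> 'I_k),
  [/\ is_finite_partition X P, (forall x, X x -> P (idx x) x) &
      forall i x y, P i x -> P i y -> x 0 = y 0].
Proof.
move=> [x0 Xx0].
pose B := [set a : A | `[< exists x, X x /\ x 0 = a >] ]%SET.
have BX x : X x -> x 0 \in B by move=> Xx; rewrite inE; apply/asboolP; exists x.
exists #|B|, (fun i => X `&` [set x | x 0 = enum_val i]).
exists (fun x => enum_rank_in (BX x0 Xx0) (x 0)); split.
- split; [split|].
  + apply/seteqP; split=> [x [i _ []]//|x Xx].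
    exists (enum_rank_in (BX x0 Xx0) (x 0)) => //; split=> //=.
    by rewrite enum_rankK_in// BX.
  + move=> i j _ _ [x [[_ /= xi] [_ /= xj]]]; apply: enum_val_inj.
    by rewrite -xi -xj.
  + move=> i _; have := enum_valP i; rewrite inE => /asboolP[x [Xx xi]].
    by exists x.
  + move=> i; apply: measurableI => //; apply: (@measurable_local _ 0) => x y xy /= <-.
    exact: xy.
- by move=> x Xx; split=> //=; rewrite enum_rankK_in// BX.
- by move=> i x y [_ /= ->] [_ /= ->].
Qed.

Lemma gibbs_free_energy mu : is_sft X -> is_irreducible X -> shift_invariant mu ->
  is_gibbs X f mu -> free_energy X f mu = p%:E.
Proof.
move=> sft irr inv gibbs; have muX : mu X = 1%E by case: gibbs.
apply/eqP; rewrite eq_le free_energy_le//=.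
have X0 := probability_nonempty muX.
have [k [P [idx [finP idxP Pinj]]]] := letter_partition X0.
have [M [C lo]] := entropy_lower_bound sX fSV sft irr inv gibbs.
rewrite /free_energy integral_potential// -leeBlDr// -EFinB.
set I := \int[mu]_(x in X) f x in lo *.
(* The two entropy bounds squeeze [join_entropy / n], so for the letter partition the limit
   exists. *)
suff pE : partition_entropy mu X (shift_map 1) P = p - I.
  by rewrite -pE; apply: ereal_sup_ubound; exists k, P.
apply/cvg_lim => //; apply/cvgrPdist_le => e e0.
have e2 : 0 < e / 2 by rewrite divr_gt0.
have [N1 N1P] := pP e2.
have [N2 N2P] := entropy_upper_bound sX fSV muX inv pP finP e0.
pose K := Num.truncn (C / (e / 2)).
exists (N1 + N2 + M + K).+1 => // n /= nN.
have n0 : 0 < n%:R :> R by rewrite ltr0n; lia.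
have h1 := N2P n ltac:(lia).
have Cn : C <= e / 2 * n%:R.
  rewrite mulrC -ler_pdivrMr// ltW//; apply: lt_le_trans (truncnS_gt _) _.
  by rewrite -/K ler_nat; lia.
have := N1P n ltac:(lia); rewrite ler_norml => /andP[h2 _].
have h3 : ln (Z n) - n%:R * I - C <= join_entropy mu X (shift_map 1) P n.
  rewrite (join_entropyE sX mu finP idxP); apply: lo; first by lia.
    exact: (measurable_itinerary sX finP idxP).
  move=> x y Xx Xy /ffunP xy i iin; have := xy (Ordinal iin); rewrite !ffunE /= => idxE.
  have hx := idxP _ (sX.2 i%:Z _ Xx); have hy := idxP _ (sX.2 i%:Z _ Xy).
  by rewrite -idxE in hy; have := Pinj _ _ _ hx hy; rewrite /shift_map !add0r.
rewrite distrC ler_norml lerBlDr lerBrDr; apply/andP; split.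
  by rewrite ler_pdivlMr//; lra.
by rewrite -/I in h1; rewrite ler_pdivrMr//; lra.
Qed.

End equilibrium.

Theorem lemma4p9 (R : realType) (A : alphabetType)
    (X : set (full_shift A)) (f : full_shift A -> R)
    (mu : probability (full_shift A) R) :
  is_sft X -> is_irreducible X -> summable_variation X f ->
  shift_invariant mu -> is_gibbs X f mu ->
  is_equilibrium X f mu.
Proof.
move=> sft irr fSV inv gibbs; have sX := sft.1.
have muX : mu X = 1%E by case: gibbs.
have X0 := probability_nonempty muX.
have [p pP] := pressure_limit sX fSV X0.
have muE := gibbs_free_energy sX fSV pP sft irr inv gibbs.
(* [mu] has free energy [p], which bounds the free energy of every invariant measure on [X]. *)
split=> //; rewrite muE; apply/eqP; rewrite eq_le; apply/andP; split.
  by apply: ereal_sup_ubound; exists mu; split.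
by apply: ge_ereal_sup => _ [nu [nuX nuinv ->]]; exact: free_energy_le.
Qed.
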